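(* Let $d\geq 1$ be an integer, let $\Omega=\mathbb{R}^d/\mathbb{Z}^d$ be the $d$-dimensional flat torus, and let $f_{\max}\geq f_{\min}>0$. Let $\mu$ be a probability measure on $\Omega$ having a density $f$ (with respect to Lebesgue measure) satisfying $f_{\min}\leq f\leq f_{\max}$, and let $1\leq p<\infty$. Then there exists a constant $C$ (not depending on $n$) such that for every integer $n\geq 1$ (with $n\geq 2$ if $d=2$), $$ \mathbb{E}\, W_p(\mu_n,\mu)\ \leq\ C\begin{cases} n^{-1/d} & \text{if } d\geq 3,\\ (\log n)^{1/2}n^{-1/2} & \text{if } d=2,\\ n^{-1/2} & \text{if } d=1,\end{cases} $$ where $\mu_n=\frac1n\sum_{j=1}^n\delta_{X_j}$ is the empirical measure of an i.i.d. sample $X_1,\dots,X_n$ of law $\mu$.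
   Context: The torus $\Omega=\mathbb{R}^d/\mathbb{Z}^d$ is endowed with its usual flat metric $\rho$ (the quotient of the Euclidean distance on $\mathbb{R}^d$) and with Lebesgue measure. For $1\leq p<\infty$ and two probability measures $\mu,\nu$ on $\Omega$, the $p$-Wasserstein distance is $$W_p(\mu,\nu)=\inf_{\pi\in\Pi(\mu,\nu)}\left(\iint \rho(x,y)^p\,\mathrm{d}\pi(x,y)\right)^{1/p},$$ where $\Pi(\mu,\nu)$ is the set of probability measures on $\Omega\times\Omega$ with first marginal $\mu$ and second marginal $\nu$. The expectation is over the sample $X_1,\dots,X_n$. *)

(* Defs.v *)
From HB Require Import structures.
From mathcomp Require Import all_boot all_order all_algebra archimedean.
From mathcomp Require Import all_classical all_reals all_analysis.
From mathcomp Require Import generic_quotient.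

Set Implicit Arguments.
Unset Strict Implicit.
Unset Printing Implicit Defensive.

Import Order.TTheory GRing.Theory Num.Theory.
Import numFieldNormedType.Exports.

Local Open Scope classical_set_scope.
Local Open Scope quotient_scope.
Local Open Scope ring_scope.

(* R^d is d.-tuple R. Its library sigma-algebra, generated by the coordinates, *)
(* is the Borel sigma-algebra.                                                 *)

Section lebesgue_tuple.
Context {R : realType}.
Local Open Scope ereal_scope.

Definition tuple_cons n (z : (R * n.-tuple R)%type) : n.+1.-tuple R :=
  [tuple of z.1 :: z.2].

Lemma measurable_tuple_cons n : measurable_fun setT (@tuple_cons n).
Proof. exact: measurable_cons. Qed.

(* d-dimensional Lebesgue measure: iterated product of the one on R *)
Fixpoint lebesgue_tuple n : set (n.-tuple R) -> \bar R :=
  match n with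
  | 0 => \d_[tuple]
  | m.+1 => pushforward (lebesgue_measure \x @lebesgue_tuple m) (@tuple_cons m)
  end.

Lemma lebesgue_tuple_sigma_finite_measure n :
  exists mu : {sigma_finite_measure set (n.-tuple R) -> \bar R},
    @lebesgue_tuple n = mu.
Proof.
elim: n => [|n [mu IHn]]; first by exists \d_[tuple].
pose nu : {measure set (measurableTypeR R * n.-tuple R)%type -> \bar R} :=
  lebesgue_measure \x mu.
have mc A : measurable A -> measurable (@tuple_cons n @^-1` A).
  by move=> mA; rewrite -[X in measurable X]setTI; exact: measurable_tuple_cons.
pose rho := @lebesgue_tuple n.+1.
have rhoE A : rho A = nu (@tuple_cons n @^-1` A).
  by rewrite /rho /= IHn.
have rho0 : rho set0 = 0 by rewrite rhoE preimage_set0 measure0.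
have rho_ge0 A : 0 <= rho A by rewrite rhoE measure_ge0.
have rho_sigma : semi_sigma_additive rho.
  move=> F mF tF mUF; rewrite rhoE preimage_bigcup.
  under eq_fun do under eq_bigr do rewrite rhoE.
  apply: (@measure_semi_sigma_additive _ _ _ nu).
  - by move=> i; exact: mc.
  - apply/trivIsetP => /= i j _ _ ij; rewrite -preimage_setI.
    by move/trivIsetP : tF => /(_ _ _ _ _ ij) ->//; rewrite preimage_set0.
  - by rewrite -preimage_bigcup; exact: mc.
have rho_fin : sigma_finite setT rho.
  have [F [UF mF]] : exists F : (set (measurableTypeR R * n.-tuple R)%type)^nat,
      setT = \bigcup_k F k /\ forall k, measurable (F k) /\ nu (F k) < +oo.
    have /sigma_finiteP[F [TF ndF Foo]] := sigma_finiteT (@lebesgue_measure R).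
    have /sigma_finiteP[G [TG ndG Goo]] := sigma_finiteT mu.
    exists (fun k => F k `*` G k); split.
      rewrite -setXTT TF TG predeqE => -[x y]; split.
        move=> [/= [i _ Fx] [k _ Gy]]; exists (maxn i k) => //; split.
        - by move: x Fx; exact/subsetPset/ndF/leq_maxl.
        - by move: y Gy; exact/subsetPset/ndG/leq_maxr.
      by move=> [k _ []/= ? ?]; split; exists k.
    move=> k; have [? ?] := Foo k; have [? ?] := Goo k.
    split; first exact: measurableX.
    have -> : nu (F k `*` G k) = lebesgue_measure (F k) * mu (G k).
      exact: product_measure1E.
    by rewrite lte_mul_pinfty// ge0_fin_numE.
  pose u (t : n.+1.-tuple R) : (R * n.-tuple R)%type := (thead t, [tuple of behead t]).
  have mu_ : measurable_fun setT u.
    apply: measurable_fun_pair; last exact: measurable_behead.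
    exact: measurable_tnth.
  have uK : cancel u (@tuple_cons n) by move=> t; rewrite [RHS]tuple_eta.
  have cK : cancel (@tuple_cons n) u.
    by move=> [x t]; rewrite /u/= theadE; congr pair; exact/val_inj.
  exists (fun k => u @^-1` F k).
    by rewrite -preimage_bigcup -UF preimage_setT.
  move=> k; have [mFk Fk_fin] := mF k; split.
    by rewrite -[X in measurable X]setTI; exact: mu_.
  rewrite rhoE -comp_preimage (_ : u \o _ = id) ?preimage_id//.
  exact/funext.
pose Mrho := isMeasure.Build _ _ _ rho rho0 rho_ge0 rho_sigma.
pose rhom : {measure set (n.+1.-tuple R) -> \bar R} := HB.pack rho Mrho.
have rho_sfin : sfinite_measure rho.
  exact: (@sfinite_measure_sigma_finite _ _ _ rhom).
pose Srho := isSFinite.Build _ _ _ rho rho_sfin.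
pose Frho := isSigmaFinite.Build _ _ _ rho rho_fin.
pose rhos : {sigma_finite_measure set (n.+1.-tuple R) -> \bar R} :=
  HB.pack rho Mrho Srho Frho.
by exists rhos.
Qed.

Section instance.
Variable n : nat.

Let lebesgue_tuple0 : @lebesgue_tuple n set0 = 0.
Proof. by have [mu ->] := lebesgue_tuple_sigma_finite_measure n. Qed.

Let lebesgue_tuple_ge0 A : 0 <= @lebesgue_tuple n A.
Proof. by have [mu ->] := lebesgue_tuple_sigma_finite_measure n. Qed.

Let lebesgue_tuple_sigma_additive : semi_sigma_additive (@lebesgue_tuple n).
Proof.
have [mu ->] := lebesgue_tuple_sigma_finite_measure n.
exact: measure_semi_sigma_additive.
Qed.

HB.instance Definition _ := isMeasure.Build _ _ _ (@lebesgue_tuple n)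
  lebesgue_tuple0 lebesgue_tuple_ge0 lebesgue_tuple_sigma_additive.

Let lebesgue_tuple_sigma_finite : sigma_finite setT (@lebesgue_tuple n).
Proof.
by have [mu ->] := lebesgue_tuple_sigma_finite_measure n; exact: sigma_finiteT.
Qed.

HB.instance Definition _ := @Measure_isSigmaFinite.Build _ _ _
  (@lebesgue_tuple n) lebesgue_tuple_sigma_finite.

End instance.
End lebesgue_tuple.

Section torus.
Context {R : realType} {d : nat}.

Definition int_cong (a b : d.-tuple R) : bool :=
  [forall i, tnth a i - tnth b i \is a Num.int].

Let int_cong_refl : reflexive int_cong.
Proof. by move=> a; apply/forallP => i; rewrite subrr. Qed.

Let int_cong_sym : symmetric int_cong.
Proof.
by move=> a b; apply/forallP/forallP => + i => /(_ i); rewrite -opprB rpredN.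
Qed.

Let int_cong_trans : transitive int_cong.
Proof.
move=> b a c /forallP ab /forallP bc; apply/forallP => i.
by rewrite -(subrKA (tnth b i)) rpredD.
Qed.

Canonical int_cong_equiv :=
  EquivRel int_cong int_cong_refl int_cong_sym int_cong_trans.

Definition torus : Type := {eq_quot int_cong}.
HB.instance Definition _ := Choice.on torus.
HB.instance Definition _ := EqQuotient.on torus.
HB.instance Definition _ := isPointed.Build torus (\pi_torus (nseq_tuple d 0)).

(* The Borel sigma-algebra of the quotient: A is measurable when its preimage  *)
(* in R^d is.                                                                  *)
Definition torus_display : measure_display.
Proof. exact: default_measure_display. Qed.

Definition torus_measurable : set (set torus) :=
  [set A | measurable (\pi_torus @^-1` A)].

Let torus_measurable0 : torus_measurable set0.
Proof. by rewrite /torus_measurable/= preimage_set0. Qed.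

Let torus_measurableC A : torus_measurable A -> torus_measurable (~` A).
Proof. by rewrite /torus_measurable/= preimage_setC; exact: measurableC. Qed.

Let torus_measurable_bigcup (F : (set torus)^nat) :
  (forall i, torus_measurable (F i)) -> torus_measurable (\bigcup_i (F i)).
Proof.
by rewrite /torus_measurable/= preimage_bigcup => ?; exact: bigcupT_measurable.
Qed.

HB.instance Definition _ := isMeasurable.Build torus_display torus
  torus_measurable0 torus_measurableC torus_measurable_bigcup.

Definition euclidean_dist (a b : d.-tuple R) : R :=
  Num.sqrt (\sum_(i < d) (tnth a i - tnth b i) ^+ 2).

(* The flat metric: infimum of the Euclidean distances between representatives. *)
Definition torus_dist (x y : torus) : R :=
  inf [set euclidean_dist a b | a in [set a | \pi_torus a = x]
                              & b in [set b | \pi_torus b = y]].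

Definition unit_cube : set (d.-tuple R) :=
  [set a | forall i, 0 <= tnth a i < 1].

Lemma measurable_unit_cube : measurable unit_cube.
Proof.
rewrite (_ : unit_cube =
  \big[setI/setT]_(i < d) ((@tnth d R)^~ i @^-1` `[0, 1[)); last first.
  apply/seteqP; split => a /=.
    by move=> a01; rewrite -bigcap_seq => i _ /=; rewrite in_itv/=.
  by rewrite -bigcap_seq => a01 i; have := a01 i; rewrite /= in_itv/=; apply;
    rewrite mem_index_enum.
apply: bigsetI_measurable => i _; rewrite -[X in measurable X]setTI.
exact: measurable_tnth.
Qed.

Local Open Scope ereal_scope.

(* Lebesgue measure on the torus, through the fundamental domain [0,1)^d. *)
Definition torus_lebesgue (A : set torus) : \bar R :=
  lebesgue_tuple ((\pi_torus @^-1` A) `&` unit_cube).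

Let torus_lebesgue0 : torus_lebesgue set0 = 0.
Proof. by rewrite /torus_lebesgue preimage_set0 set0I measure0. Qed.

Let torus_lebesgue_ge0 A : 0 <= torus_lebesgue A.
Proof. exact: measure_ge0. Qed.

Let torus_lebesgue_sigma_additive : semi_sigma_additive torus_lebesgue.
Proof.
move=> F mF tF mUF; rewrite /torus_lebesgue preimage_bigcup setI_bigcupl.
apply: measure_semi_sigma_additive.
- by move=> i; apply: measurableI; [exact: mF|exact: measurable_unit_cube].
- apply: trivIset_setIr; apply/trivIsetP => i j _ _ ij.
  rewrite -preimage_setI.
  by move/trivIsetP : tF => /(_ _ _ _ _ ij) ->//; rewrite preimage_set0.
- rewrite -setI_bigcupl -preimage_bigcup.
  by apply: measurableI; [exact: mUF|exact: measurable_unit_cube].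
Qed.

HB.instance Definition _ := isMeasure.Build _ _ _ torus_lebesgue
  torus_lebesgue0 torus_lebesgue_ge0 torus_lebesgue_sigma_additive.

End torus.
Arguments torus R d : clear implicits.

Section wasserstein.
Context {R : realType} {d : nat}.
Local Notation T := (torus R d).
Local Open Scope ereal_scope.

Definition couplings (mu nu : {measure set T -> \bar R}) :
    set (probability (T * T)%type R) :=
  [set pi | (forall A, measurable A -> pi (fst @^-1` A) = mu A) /\
            (forall B, measurable B -> pi (snd @^-1` B) = nu B)].

(* Only used between measures of mass 1; otherwise there is no coupling and    *)
(* the value is +oo.                                                           *)
Definition wasserstein (p : R) (mu nu : {measure set T -> \bar R}) : \bar R :=
  ereal_inf [set (\int[pi]_z ((torus_dist z.1 z.2) `^ p)%:E) `^ p^-1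
            | pi in couplings mu nu].

End wasserstein.

Section empirical_measure.
Context {disp : measure_display} {T : measurableType disp} {R : realType}.
Variables (n : nat) (x : 'I_n -> T).
Local Open Scope ereal_scope.

Definition empirical_measure (A : set T) : \bar R :=
  (n%:R^-1)%:E * \sum_(j < n) \d_(x j) A.

Let empirical_mscale : exists mu : {measure set T -> \bar R},
  empirical_measure = mu.
Proof.
pose m (k : nat) : {measure set T -> \bar R} :=
  if insub k is Some j then \d_(x j) else mzero.
exists (mscale ((n%:R^-1)%:nng)%R (msum m n)).
apply/funext => A; congr (_ * _); apply: eq_bigr => j _.
by rewrite /m valK.
Qed.

Let empirical_measure0 : empirical_measure set0 = 0.
Proof. by have [mu ->] := empirical_mscale. Qed.

Let empirical_measure_ge0 A : 0 <= empirical_measure A.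
Proof. by have [mu ->] := empirical_mscale. Qed.

Let empirical_measure_sigma_additive : semi_sigma_additive empirical_measure.
Proof.
by have [mu ->] := empirical_mscale; exact: measure_semi_sigma_additive.
Qed.

HB.instance Definition _ := isMeasure.Build _ _ _ empirical_measure
  empirical_measure0 empirical_measure_ge0 empirical_measure_sigma_additive.

End empirical_measure.

Section iid.
Context {disp disp' : measure_display} {W : measurableType disp}
  {T : measurableType disp'} {R : realType}.
Local Open Scope ereal_scope.

Definition independent_RVs (P : probability W R) (n : nat)
    (X : 'I_n -> {RV P >-> T}) : Prop :=
  forall (J : {set 'I_n}) (A : 'I_n -> set T), (forall i, measurable (A i)) ->
    P (\bigcap_(i in [set` J]) (X i @^-1` A i)) =
    \prod_(i in J) P (X i @^-1` A i).

Definition iid_sample (mu : probability T R) (P : probability W R) (n : nat)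
    (X : 'I_n -> {RV P >-> T}) : Prop :=
  independent_RVs X /\
  forall i A, measurable A -> distribution P (X i) A = mu A.

End iid.

(* The case d = 0 is a placeholder. *)
Definition convergence_rate (R : realType) (d n : nat) : R :=
  match d with
  | 0 | 1 => n%:R `^ (- 2^-1)
  | 2 => ln n%:R `^ 2^-1 * n%:R `^ (- 2^-1)
  | _ => n%:R `^ (- d%:R^-1)
  end.

(* Main.v *)
Require Import Defs.
From HB Require Import structures.
From mathcomp Require Import all_boot all_order all_algebra archimedean.
From mathcomp Require Import all_classical all_reals all_analysis.
From mathcomp Require Import measurable_realfun.
From mathcomp Require Import generic_quotient.
From mathcomp Require Import zify ring lra.

(** The proof replaces the torus by a finite grid and the Wasserstein distance
by the cost of an explicit random walk on that grid.

Cut the torus into [N ^ d] cubes of side [1 / N], with [N ^ d] of order [n].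
Moving mass inside a cube costs at most a multiple of [1 / N], hence of the
claimed rate, so only the masses of the cubes matter: [a] for [mu] and [b] for
the empirical measure.  It suffices to bound a high even power of the distance,
[q = 2 (r + 1) >= p], since [W_p <= W_q].

(1) Dynamical transport ([flow_coupling]).  If a flow [f] between neighbouring
cubes has divergence [b - a], then particles distributed as [a] can be carried
to [b] along the interpolation [(1 - tau) b + tau a] by a Markov chain that
jumps along [f].  The rate of jumps out of [x] is the outflow divided by the
current mass, which is at least [tau a x], so the chain makes few jumps when the
flow is small compared with [a]: the [q]-th moment of the displacement, in units
of [1 / N], is at most a constant times [1 + sum_x out(x) ^ q / a x ^ (q - 1)].
This is a discrete form of the estimate of [W_q] by an [L^q] norm of a vector
field of divergence [b - a], and it is here that the lower bound on the density
enters.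

(2) A flow that is linear in [b - a] ([flux], [flux_div], [grid_flux_div]).  A
point mass at [z] is spread out to the uniform measure through the dyadic cubes
containing [z], one scale and one coordinate at a time.  At a boundary [v] the
resulting kernel is at most the sum of [2 ^ (- m (d - 1))] over the scales [m]
for which [v] and [z] lie in a common cube of side [2 ^ (m + 1)], a discrete
analogue of the gradient [|v - z| ^ (1 - d)] of the Green function.

(3) Moments ([iid_moment]).  By linearity the flow through a given boundary is
an average of [n] independent centred bounded variables, and a Rosenthal
inequality bounds its [q]-th moment in terms of its variance.  Summing all scales inside
the variance, instead of adding up standard deviations scale by scale, is what
gives [(log n) ^ (1/2)] and not [log n] when [d = 2].  The sum
[sum_m 2 ^ (m (2 - d))] which appears there ([flux_energy]) is bounded for
[d >= 3] and of order [log n] for [d = 2].  For [d = 1] the dyadic scales are replaced by a single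
scale with [N = n] cells.

(4) Return to the torus ([finite_coupling_lift], [wasserstein_le],
[expected_wasserstein_le]).  A coupling of the masses lifts to a coupling of the
measures, and the cells of an i.i.d. sample are i.i.d. with law [a], so the
expectation becomes a finite sum. *)

Set Implicit Arguments.
Unset Strict Implicit.
Unset Printing Implicit Defensive.

Import Order.TTheory GRing.Theory Num.Theory.
Import numFieldNormedType.Exports.

Local Open Scope classical_set_scope.
Local Open Scope ring_scope.

(** * Elementary inequalities *)

(** Young's inequality without exponents: compare [r] with [k * x]. *)
Lemma young_expr (R : realFieldType) (p : nat) (r x k : R) :
  0 <= r -> 0 <= x -> 0 < k ->
  r * x ^+ p <= r ^+ p.+1 / k ^+ p + k * x ^+ p.+1.
Proof.
move=> r0 x0 k0; have kp0 : 0 < k ^+ p by rewrite exprn_gt0.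
have [rkx|kxr] := leP r (k * x).
  rewrite -[leLHS]add0r lerD ?divr_ge0 ?exprn_ge0 ?(ltW k0)//.
  by rewrite exprS mulrA ler_wpM2r// exprn_ge0.
rewrite -[leLHS]addr0 lerD ?mulr_ge0 ?exprn_ge0 ?(ltW k0)//.
rewrite ler_pdivlMr// exprS -mulrA ler_wpM2l// -exprMn.
by rewrite lerXn2r ?nnegrE ?mulr_ge0 ?(ltW k0)// mulrC ltW.
Qed.

Lemma expr_succ_le (R : realFieldType) (p : nat) (x : R) :
  1 <= x -> (x + 1) ^+ p.+1 <= x ^+ p.+1 + 3 ^+ p * x ^+ p.
Proof.
move=> x1; have x0 : 0 <= x by rewrite (le_trans _ x1).
elim: p => [|p IH]; first by rewrite !expr1 !expr0 mulr1.
rewrite exprSr (le_trans (ler_wpM2r _ IH)) ?addr_ge0//.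
have y0 : 0 <= x ^+ p by rewrite exprn_ge0.
have z1 : 1 <= 3 ^+ p :> R by rewrite exprn_ege1// ler1n.
have -> : x ^+ p.+2 = x * x * x ^+ p by rewrite !exprS mulrA.
have -> : x ^+ p.+1 = x * x ^+ p by rewrite exprS.
have -> : 3 ^+ p.+1 = 3 * 3 ^+ p :> R by rewrite exprS.
move: (x ^+ p) (3 ^+ p) y0 z1 => y z y0 z1.
have : 0 <= (z - 1) * (x * y) by rewrite mulr_ge0 ?subr_ge0// mulr_ge0.
have : 0 <= (z * y) * (x - 1).
  by rewrite mulr_ge0 ?subr_ge0// mulr_ge0 ?(le_trans _ z1).
nra.
Qed.

Lemma expr_interp (R : realFieldType) (S Z : R) (i m : nat) :
  0 <= S -> 0 <= Z -> S ^+ i * Z ^+ (m + 2) <= S ^+ (i + m) * Z ^+ 2 + Z ^+ (i + m + 2).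
Proof.
move=> S0 Z0; have [SZ|ZS] := leP S Z.
  rewrite -[leLHS]add0r lerD ?mulr_ge0 ?exprn_ge0//.
  rewrite -addnA [in leRHS]exprD ler_wpM2r ?exprn_ge0//.
  by rewrite lerXn2r.
rewrite -[leLHS]addr0 lerD ?exprn_ge0//.
rewrite !exprD mulrA ler_wpM2r ?exprn_ge0//.
by rewrite ler_wpM2l ?exprn_ge0// lerXn2r ?nnegrE// ltW.
Qed.

(** Second-order Taylor bound for powers.  The middle terms of the binomial
formula are interpolated between the extreme ones by [expr_interp].  The
absolute values disappear when the exponent is even. *)
Lemma expr_second_order (R : realFieldType) (S Z : R) (m : nat) :
  (S + Z) ^+ m.+2 <= S ^+ m.+2 + m.+2%:R * S ^+ m.+1 * Z
    + 2 ^+ m.+2 * (`|S| ^+ m * `|Z| ^+ 2 + `|Z| ^+ m.+2).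
Proof.
rewrite exprDn big_ord_recl big_ord_recl /= !subn0 !expr0 !mulr1 bin0 mulr1n.
rewrite /bump /= !addn0 subSS subn0 bin1 expr1 -[leRHS]addrA lerD2l.
rewrite -mulrA -mulr_natl lerD2l.
set W : R := (X in _ <= _ * X).
have W0 : 0 <= W.
  by rewrite /W; apply: addr_ge0; [apply: mulr_ge0|]; apply: exprn_ge0.
have -> : 2 ^+ m.+2 * W = \sum_(i < m.+3) W *+ 'C(m.+2, i).
  have /(congr1 (fun x => x * W)) := exprDn (1 : R) 1 m.+2.
  rewrite (_ : 1 + 1 = 2)// => ->; rewrite mulr_suml; apply: eq_bigr => i _.
  by rewrite !expr1n mulr1 mulr_natl.
rewrite [leRHS]big_ord_recl [X in _ <= _ + X]big_ord_recl /= addrA.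
rewrite -[leLHS]add0r lerD//.
  by rewrite addr_ge0// mulrn_wge0.
apply: ler_sum => i _; rewrite /bump /= !add1n lerMn2r; apply/orP; right.
rewrite -[(m.+2 - _)%N]/(m - i)%N (le_trans (ler_norm _))// normrM !normrX.
have im : (i <= m)%N by rewrite -ltnS.
have := @expr_interp R `|S| `|Z| (m - i) i (normr_ge0 _) (normr_ge0 _).
by rewrite addn2 subnK// addn2.
Qed.

(** One step of a discrete Gronwall argument: [A] is the source term, and the
factors [expR e] multiply up along an induction. *)
Lemma gronwall_step (R : realType) (A E e u u' : R) :
  0 <= u + A -> u + A <= E -> u' <= u + e * (u + A) -> u' + A <= E * expR e.
Proof.
move=> uA0 uAE u'u; rewrite (@le_trans _ _ ((u + A) * (1 + e)))//; first by lra.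
rewrite (le_trans (ler_wpM2l uA0 (expR_ge1Dx e)))//.
by rewrite ler_wpM2r ?expR_ge0.
Qed.

Lemma bernoulli_le (R : realFieldType) (e : R) (n : nat) :
  0 <= e -> e <= 1 -> 1 - (1 - e) ^+ n <= n%:R * e.
Proof.
move=> e0 e1; elim: n => [|n IH]; first by rewrite expr0 subrr mul0r.
have y1 : (1 - e) ^+ n <= 1 by rewrite exprn_ile1 ?subr_ge0//; lra.
rewrite exprSr -natr1; nra.
Qed.

Lemma geometric_le (R : realFieldType) (e : R) (n : nat) :
  0 <= e -> e <= 1 -> (1 - e) ^+ n * (1 + n%:R * e) <= 1.
Proof.
move=> e0 e1; elim: n => [|n IH]; first by rewrite expr0 mul0r addr0 mulr1.
apply: le_trans IH; rewrite exprSr -mulrA ler_wpM2l ?exprn_ge0 ?subr_ge0//.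
rewrite -natr1; have : 0 <= n%:R * e ^+ 2 :> R by rewrite mulr_ge0 ?exprn_ge0.
nra.
Qed.

(** * Transport along a flow on a finite set *)

Definition is_coupling (R : realFieldType) (G H : finType) (pi : G -> H -> R)
    (a : G -> R) (b : H -> R) : Prop :=
  [/\ forall x y, 0 <= pi x y, forall x, \sum_y pi x y = a x
    & forall y, \sum_x pi x y = b y].

Definition transport_cost (R : realFieldType) (G H : finType) (pi : G -> H -> R)
    (c : G -> H -> R) : R := \sum_x \sum_y pi x y * c x y.

Definition is_kernel (R : realFieldType) (G H : finType) (P : G -> H -> R) : Prop :=
  (forall x y, 0 <= P x y) /\ (forall x, \sum_y P x y = 1).

Lemma coupling_comp (R : realFieldType) (F G H : finType) (pi : F -> G -> R)
    (a : F -> R) (m : G -> R) (P : G -> H -> R) :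
  is_coupling pi a m -> is_kernel P ->
  is_coupling (fun x z => \sum_y pi x y * P y z) a (fun z => \sum_y m y * P y z).
Proof.
move=> [pi0 pia pim] [P0 P1]; split.
- by move=> x z; apply: sumr_ge0 => y _; rewrite mulr_ge0.
- move=> x; rewrite exchange_big -pia /=; apply: eq_bigr => y _.
  by rewrite -mulr_sumr P1 mulr1.
- move=> z; rewrite exchange_big /=; apply: eq_bigr => y _.
  by rewrite -mulr_suml pim.
Qed.

Lemma cost_comp_le (R : realFieldType) (F G H : finType) (pi : F -> G -> R)
    (P : G -> H -> R) (c' : F -> H -> R) (c g : F -> G -> R) :
  (forall x y, 0 <= pi x y) ->
  (forall x y, \sum_z P y z * c' x z <= c x y + g x y) ->
  transport_cost (fun x z => \sum_y pi x y * P y z) c' <=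
  transport_cost pi c + transport_cost pi g.
Proof.
move=> pi0 Pcg; rewrite /transport_cost -big_split /=.
apply: ler_sum => x _; rewrite -big_split /=.
under eq_bigr do rewrite mulr_suml.
rewrite exchange_big /=; apply: ler_sum => y _.
under eq_bigr do rewrite -mulrA.
by rewrite -mulr_sumr -mulrDr ler_wpM2l.
Qed.

Lemma transport_cost_ge0 (R : realFieldType) (G H : finType) (pi : G -> H -> R)
    (c : G -> H -> R) : (forall x y, 0 <= pi x y) -> (forall x y, 0 <= c x y) ->
  0 <= transport_cost pi c.
Proof. by move=> *; do 2!apply: sumr_ge0 => ? _; rewrite mulr_ge0. Qed.

(** One step of the Markov chain: mass [h * f x y] jumps from [x] to [y], out of
the mass [m x] present, and moves the second marginal by [h] times the
divergence of [f].  A jump increases [(1 + rho) ^ p.+1] by at most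
[3 ^ p * (1 + rho) ^ p], and Young's inequality with weight [k] separates the
jump rate from the displacement already accumulated. *)
Lemma flow_step (R : realFieldType) (G : finType) (rho : G -> G -> R)
    (f : G -> G -> R) (a m : G -> R) (pi : G -> G -> R) (h k : R) (p : nat) :
  (forall x y, 0 <= rho x y) ->
  (forall x y z, f y z != 0 -> rho x z <= rho x y + 1) ->
  (forall x y, 0 <= f x y) -> (forall x, 0 < m x) -> 0 <= h -> 0 < k ->
  (forall x, h * (\sum_y f x y) <= m x) ->
  is_coupling pi a m ->
  exists pi' : G -> G -> R,
    is_coupling pi' a (fun y => m y + h * (\sum_x f x y - \sum_x f y x)) /\
    transport_cost pi' (fun x y => (1 + rho x y) ^+ p.+1) <=
    transport_cost pi (fun x y => (1 + rho x y) ^+ p.+1) +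
    3 ^+ p * h * (k * transport_cost pi (fun x y => (1 + rho x y) ^+ p.+1) +
      (\sum_x (\sum_y f x y) ^+ p.+1 / m x ^+ p) / k ^+ p).
Proof.
move=> rho0 frho f0 m0 h0 k0 hm piam.
set out := fun x => \sum_y f x y.
have out0 x : 0 <= out x by apply: sumr_ge0.
pose P x y := h * f x y / m x + (x == y)%:R * (1 - h * out x / m x).
have hom x : h * out x / m x <= 1 by rewrite ler_pdivrMr ?mul1r ?hm.
have P0 x y : 0 <= P x y.
  by rewrite addr_ge0 ?divr_ge0 ?mulr_ge0 ?(ltW (m0 _))// subr_ge0.
have Psum (F : G -> R) x : \sum_y P x y * F y =
    F x + (h / m x) * \sum_y f x y * (F y - F x).
  rewrite /P; under eq_bigr do rewrite mulrDl.
  rewrite big_split /= [X in _ + X](bigD1 x) //= eqxx mul1r.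
  rewrite [X in _ + (_ + X)]big1 ?addr0; last first.
    by move=> y /negPf xy; rewrite eq_sym xy !mul0r.
  under [in RHS]eq_bigr do rewrite mulrBr.
  rewrite sumrB -mulr_suml -/(out x).
  have -> : \sum_y h * f x y / m x * F y = h / m x * \sum_y f x y * F y.
    by rewrite mulr_sumr; apply: eq_bigr => y _; ring.
  by ring.
have Pk : is_kernel P.
  split=> // x; have := Psum (fun=> 1) x.
  under eq_bigr do rewrite mulr1.
  by move=> ->; rewrite big1 ?mulr0 ?addr0// => y _; rewrite subrr mulr0.
have [pi0 pia pim] := piam.
exists (fun x z => \sum_y pi x y * P y z); split.
  have [A1 A2 A3] := coupling_comp piam Pk; split=> // y.
  rewrite A3 /P; under eq_bigr do rewrite mulrDr.
  rewrite big_split /= [X in _ + X](bigD1 y) //= eqxx mul1r.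
  rewrite [X in _ + (_ + X)]big1 ?addr0; last first.
    by move=> x /negPf xy; rewrite xy !mul0r mulr0.
  rewrite mulrBr mulr1 mulrBr -/(out y).
  have -> : m y * (h * out y / m y) = h * out y.
    by rewrite mulrC divfK// gt_eqF.
  have -> : \sum_x m x * (h * f x y / m x) = h * \sum_x f x y.
    rewrite mulr_sumr; apply: eq_bigr => x _.
    by rewrite mulrC divfK// gt_eqF.
  by ring.
pose c x y := (1 + rho x y) ^+ p.+1.
apply: (le_trans (@cost_comp_le _ _ _ _ pi P c c
  (fun x y => 3 ^+ p * h * (k * c x y + (out y / m y) ^+ p.+1 / k ^+ p)) _ _)) => //.
  move=> x y; rewrite Psum lerD2l.
  have r1 : 1 <= 1 + rho x y by rewrite lerDl.
  have r0 : 0 <= 1 + rho x y by rewrite (le_trans _ r1).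
  apply: (@le_trans _ _ (h / m y * (out y * (3 ^+ p * (1 + rho x y) ^+ p)))).
    rewrite ler_wpM2l ?divr_ge0 ?(ltW (m0 _))// /out mulr_suml ler_sum// => z _.
    have [->|fyz] := eqVneq (f y z) 0; first by rewrite !mul0r.
    rewrite ler_wpM2l// lerBlDl (le_trans _ (expr_succ_le _ r1))//.
    by rewrite lerXn2r ?nnegrE ?addr_ge0// -addrA lerD2l frho.
  have -> : h / m y * (out y * (3 ^+ p * (1 + rho x y) ^+ p)) =
    3 ^+ p * h * (out y / m y * (1 + rho x y) ^+ p) by ring.
  rewrite ler_wpM2l ?mulr_ge0 ?exprn_ge0//.
  by rewrite [leRHS]addrC young_expr ?divr_ge0 ?(ltW (m0 _)).
rewrite lerD2l /transport_cost.
under eq_bigr do under eq_bigr do rewrite mulrCA.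
under eq_bigr do rewrite -mulr_sumr.
rewrite -mulr_sumr ler_wpM2l ?mulr_ge0 ?exprn_ge0//.
under eq_bigr do under eq_bigr do rewrite mulrDr.
under eq_bigr do rewrite big_split /=.
rewrite big_split /= lerD//.
  under eq_bigr do under eq_bigr do rewrite mulrCA.
  by under eq_bigr do rewrite -mulr_sumr; rewrite -mulr_sumr.
rewrite exchange_big /= mulr_suml ler_sum// => y _.
rewrite -mulr_suml pim mulrA ler_wpM2r ?invr_ge0 ?exprn_ge0 ?(ltW k0)//.
have my : m y != 0 by rewrite gt_eqF.
rewrite le_eqVlt expr_div_n [m y ^+ p.+1]exprS; apply/orP; left; apply/eqP.
by rewrite /out; field; rewrite my expf_neq0.
Qed.

(** The chain follows [m s = (1 - tau s) * b + tau s * a] with [tau s = th s ^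
p.+1] and [th] geometric.  With the weight [k = th s ^- p] in [flow_step], both
the growth rate and the source term become multiples of [e * th s], whose sum
over [s] telescopes to at most [1] although the lower bound [tau s * a] on the
mass degenerates.  The remaining mass [tau T] is finally sent to [b] in one
arbitrary jump, at a cost made at most [1] by the choice of [T]. *)
Lemma flow_coupling (R : realType) (G : finType) (rho : G -> G -> R) (D : R)
    (f : G -> G -> R) (a b : G -> R) (p : nat) :
  (forall x, rho x x = 0) -> (forall x y, 0 <= rho x y <= D) ->
  (forall x y z, f y z != 0 -> rho x z <= rho x y + 1) ->
  (forall x y, 0 <= f x y) -> (forall x, 0 < a x) -> (forall x, 0 <= b x) ->
  \sum_x a x = 1 -> \sum_x b x = 1 ->
  (forall y, b y - a y = \sum_x f x y - \sum_x f y x) ->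
  exists pi : G -> G -> R, is_coupling pi a b /\
    transport_cost pi (fun x y => (1 + rho x y) ^+ p.+1) <=
    (expR (3 ^+ p * p.+1%:R) + 1) *
    (1 + \sum_x (\sum_y f x y) ^+ p.+1 / a x ^+ p).
Proof.
move=> rhoxx rhoD frho f0 a0 b0 a1 b1 fab.
have rho0 x y : 0 <= rho x y by have /andP[] := rhoD x y.
set A := \sum_x _; pose out x := \sum_y f x y.
have out0 x : 0 <= out x by apply: sumr_ge0.
have A0 : 0 <= A.
  by apply: sumr_ge0 => x _; rewrite divr_ge0 ?exprn_ge0 ?(ltW (a0 _))// out0.
pose M : R := p.+1%:R * \sum_x out x / a x.
have M0 : 0 <= M.
  by rewrite mulr_ge0// sumr_ge0// => x _; rewrite divr_ge0 ?(ltW (a0 _)).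
(* Small enough for every step to respect the mass constraint of flow_step. *)
pose e := (M + 2)^-1.
have M2 : 0 < M + 2 by lra.
have e0 : 0 < e by rewrite invr_gt0.
have e1 : e < 1 by rewrite /e invf_lt1// ltr_wpDl// ltr1n.
have eout x : p.+1%:R * e * out x <= a x.
  have -> : p.+1%:R * e * out x = (p.+1%:R * out x) / (M + 2) by rewrite mulrAC.
  rewrite ler_pdivrMr// -ler_pdivrMl// (@le_trans _ _ M)//; last by rewrite lerDl.
  rewrite mulrCA ler_wpM2l// mulrC (bigD1 x)//= lerDl sumr_ge0// => y _.
  by rewrite divr_ge0 ?(ltW (a0 _)).
pose th s := (1 - e) ^+ s.
have th0 s : 0 < th s by rewrite exprn_gt0// subr_gt0.
have th1 s : th s <= 1 by rewrite exprn_ile1//; lra.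
have thS s : th s.+1 = th s * (1 - e) by rewrite /th exprSr.
pose tau s := th s ^+ p.+1.
have tau0 s : 0 < tau s by rewrite exprn_gt0.
have tau1 s : tau s <= 1 by rewrite exprn_ile1// ltW.
pose m s x := (1 - tau s) * b x + tau s * a x.
have am s x : tau s * a x <= m s x by rewrite lerDr mulr_ge0 ?subr_ge0.
have m0 s x : 0 < m s x by apply: lt_le_trans (am s x); rewrite mulr_gt0.
pose c x y := (1 + rho x y) ^+ p.+1.
have c0 x y : 0 <= c x y by rewrite exprn_ge0// addr_ge0.
pose l : R := 3 ^+ p * p.+1%:R.
have H s : exists pi, is_coupling pi a (m s) /\
    transport_cost pi c + A <= (1 + A) * expR (l * (1 - th s)).
  elim: s => [|s [pi [piam IH]]].
    exists (fun x y => (x == y)%:R * a x); split.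
      split.
      - by move=> x y; rewrite mulr_ge0// ltW.
      - move=> x; rewrite (bigD1 x)//= eqxx mul1r big1 ?addr0// => y.
        by rewrite eq_sym => /negPf->; rewrite mul0r.
      - move=> x; rewrite (bigD1 x)//= eqxx mul1r big1 ?addr0.
          by rewrite /m /tau /th expr0 expr1n; ring.
        by move=> y /negPf->; rewrite mul0r.
    rewrite /th expr0 subrr mulr0 expR0 mulr1 lerD2r -[leRHS]a1 /transport_cost.
    rewrite ler_sum// => x _; rewrite (bigD1 x)//= eqxx mul1r big1 ?addr0.
      by rewrite /c rhoxx addr0 expr1n mulr1.
    by move=> y; rewrite eq_sym => /negPf->; rewrite !mul0r.
  pose h := tau s - tau s.+1.
  have hle : h <= p.+1%:R * e * tau s.
    rewrite /h /tau thS exprMn -[X in X - _]mulr1 -mulrBr mulrC.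
    by rewrite ler_wpM2r ?(ltW (tau0 _))// bernoulli_le ?ltW.
  have h0 : 0 <= h.
    rewrite subr_ge0 /tau lerXn2r ?nnegrE ?(ltW (th0 _))// thS.
    by rewrite ler_piMr ?(ltW (th0 _))//; lra.
  have thp0 : 0 < th s ^+ p by rewrite exprn_gt0.
  have k0 : 0 < (th s ^+ p)^-1 by rewrite invr_gt0.
  have hout x : h * (\sum_y f x y) <= m s x.
    apply: le_trans (am s x); rewrite -/(out x).
    rewrite (le_trans (ler_wpM2r (out0 x) hle))//.
    by rewrite mulrAC mulrC ler_wpM2l ?(ltW (tau0 _))// eout.
  have [pi' [pi'a pi'c]] := flow_step p rho0 frho f0 (m0 s) h0 k0 hout piam.
  exists pi'; split.
    have -> : m s.+1 = fun y => m s y + h * (\sum_x f x y - \sum_x f y x).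
      by apply/funext => y; rewrite -fab /m /h; ring.
    exact: pi'a.
  rewrite (_ : 1 - th s.+1 = (1 - th s) + e * th s); last first.
    by rewrite thS; ring.
  rewrite mulrDr expRD mulrA.
  have u0 : 0 <= transport_cost pi c.
    by apply: transport_cost_ge0 => //; case: piam.
  apply: gronwall_step IH _; first by rewrite addr_ge0.
  apply: (le_trans pi'c); rewrite lerD2l -/c /l -!mulrA ler_wpM2l ?exprn_ge0//.
  have -> : p.+1%:R * (e * (th s * (transport_cost pi c + A))) =
     p.+1%:R * e * tau s / th s ^+ p * (transport_cost pi c + A).
    rewrite /tau exprS; field.
    by rewrite expf_neq0 // gt_eqF.
  apply: (@le_trans _ _ (h / th s ^+ p * (transport_cost pi c + A))); last first.
    rewrite ler_wpM2r ?(addr_ge0 u0 A0)// ler_wpM2r ?invr_ge0 ?(ltW thp0)//.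
  rewrite -mulrA ler_wpM2l// mulrDr lerD2l.
  rewrite -/(out _) /A mulr_suml mulr_sumr ler_sum// => x _.
  rewrite -/(out x) exprVn invrK mulrCA -mulrA ler_wpM2l ?exprn_ge0//.
  have ap0 : 0 < a x ^+ p by rewrite exprn_gt0.
  rewrite mulrC ler_pdivrMr ?exprn_gt0// -mulrA ler_pdivlMl// ler_pdivlMl//.
  have -> : a x ^+ p * (th s ^+ p * (th s ^+ p) ^+ p) = (tau s * a x) ^+ p.
    by rewrite /tau exprS !exprMn mulrC.
  by rewrite lerXn2r ?nnegrE ?am// ?mulr_ge0 ?(ltW (a0 _)) ?(ltW (tau0 _)) ?(ltW (m0 _ _)).
(* [D] bounds the diameter, so one arbitrary jump of the mass [tau T] costs at most [1]. *)
have [T HT] : exists T, th T * (1 + D) <= 1.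
  have D0 : 0 <= D.
    have [x _|noG] := pickP (@predT G).
      by have /andP[r0 rD] := rhoD x x; exact: le_trans rD.
    by move: a1; rewrite (eq_bigl _ _ noG) big_pred0_eq => /esym/eqP; rewrite oner_eq0.
  have D1 : 0 <= D / e by exact: divr_ge0 D0 (ltW e0).
  exists (Num.bound (D / e)).
  have /(_ (Num.bound (D / e)))/(_ (ltW e0) (ltW e1)) := @geometric_le R e.
  apply: le_trans; rewrite ler_wpM2l ?(ltW (th0 _))// lerD2l.
  rewrite -ler_pdivrMr//; have := archi_boundP D1; exact: ltW.
have [pi [piam IH]] := H T.
(* The part of the mass coming from [b] stays, the part coming from [a] is redrawn from [b]. *)
pose P x y := ((x == y)%:R * ((1 - tau T) * b x) + tau T * a x * b y) / m T x.
have Psum (F : G -> R) x : \sum_y P x y * F y =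
    ((1 - tau T) * b x * F x + tau T * a x * \sum_y b y * F y) / m T x.
  rewrite mulr_sumr [in RHS]mulrDl [X in _ = _ + X]mulr_suml /P.
  under eq_bigr do rewrite 2!mulrDl.
  rewrite big_split /= (bigD1 x)//= eqxx mul1r [X in _ + X + _]big1 ?addr0.
    by congr (_ + _); [ring|apply: eq_bigr => y _; ring].
  by move=> y; rewrite eq_sym => /negPf->; rewrite !mul0r.
have mm (y : G) : m T y != 0 by rewrite gt_eqF.
have Pk : is_kernel P.
  split=> [x y|x].
    by rewrite divr_ge0 ?(ltW (m0 _ _))// addr_ge0// !mulr_ge0 ?subr_ge0// ltW.
  have := Psum (fun=> 1) x; under eq_bigr do rewrite mulr1.
  move=> ->; under eq_bigr do rewrite mulr1.
  by rewrite b1 !mulr1 -/(m T x) divff.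
exists (fun x z => \sum_y pi x y * P y z); split.
  have := coupling_comp piam Pk; congr (is_coupling _ _ _); apply/funext => z.
  rewrite /P; under eq_bigr do rewrite mulrC divfK//.
  rewrite big_split /= (bigD1 z)//= eqxx mul1r big1 ?addr0.
    by rewrite -mulr_suml -mulr_sumr a1 mulr1; ring.
  by move=> y /negPf->; rewrite mul0r.
have [pi0 pia pim] := piam.
apply: (le_trans (@cost_comp_le _ _ _ _ pi P c c
  (fun x y => a y / m T y) pi0 _)).
  move=> x y; rewrite Psum.
  rewrite ler_pdivrMr// [leRHS]mulrDl divfK// -/(m T y) lerD//.
    by rewrite mulrC ler_wpM2l// /m lerDl mulr_ge0// ltW.
  rewrite mulrAC mulrC -[leRHS]mulr1 ler_wpM2l ?(ltW (a0 _))//.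
  have cD z : c x z <= (1 + D) ^+ p.+1.
    have /andP[r0 rD] := rhoD x z.
    rewrite /c lerXn2r ?nnegrE ?lerD2l ?addr_ge0//; exact: le_trans rD.
  apply: (@le_trans _ _ (tau T * (1 + D) ^+ p.+1)).
    rewrite ler_wpM2l ?(ltW (tau0 _))//.
    apply: (@le_trans _ _ (\sum_z b z * (1 + D) ^+ p.+1)).
      by apply: ler_sum => z _; apply: ler_wpM2l.
    by rewrite -mulr_suml b1 mul1r.
  have /andP[r0 rD] := rhoD x y.
  by rewrite /tau -exprMn exprn_ile1// mulr_ge0 ?(ltW (th0 _))//; lra.
have -> : transport_cost pi (fun x y => a y / m T y) = 1.
  rewrite /transport_cost exchange_big /= -[RHS]a1; apply: eq_bigr => y _.
  by rewrite -mulr_suml pim mulrC divfK.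
have : transport_cost pi c <= (1 + A) * expR l.
  apply: (@le_trans _ _ (transport_cost pi c + A)); first by rewrite lerDl.
  apply: (le_trans IH); rewrite ler_wpM2l ?addr_ge0// ler_expR.
  by rewrite ler_piMr ?mulr_ge0 ?exprn_ge0// gerBl ltW.
by rewrite [X in _ -> _ <= X]mulrDl mul1r => cA; rewrite lerD ?lerDl// mulrC.
Qed.

(** * The multiscale flux of a point mass *)

Lemma block_step (q k t : nat) : (0 < q)%N ->
  (minn q (t.+1 - k * q) = minn q (t - k * q) + (t %/ q == k))%N.
Proof.
move=> q0; have -> : (t %/ q == k)%N = (k * q <= t < k.+1 * q)%N.
  by rewrite -leq_divRL// -ltn_divLR// ltnS eqn_leq andbC.
by rewrite mulSn; case: (leqP (k * q) t) => /=; case: (ltnP t (q + k * q)) => /=; lia.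
Qed.

(** Blocks are nested: the blocks of lengths [q] and [r * q] around [s] are
compared through their endpoints. *)
Lemma block_nested (q r s : nat) : (0 < q)%N -> (0 < r)%N ->
  (s %/ (r * q) * (r * q) <= s %/ q * q /\
   (s %/ q).+1 * q <= (s %/ (r * q)).+1 * (r * q))%N.
Proof.
move=> q0 r0; rewrite [(r * q)%N]mulnC divnMA [(q * r)%N]mulnC !mulnA !leq_mul2r.
by rewrite leq_trunc_div ltn_ceil ?orbT.
Qed.

Section block.
Context {R : realType}.

(** The uniform probability on the block of length [q] containing [s], the
blocks being [[k q, (k + 1) q)]. *)
Definition block_density (q s t : nat) : R := (t %/ q == s %/ q)%N%:R / q%:R.

(** The mass that [block_density q s] gives to [[0, t)]. *)
Definition block_cdf (q s t : nat) : R :=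
  (minn q (t - s %/ q * q)%N)%:R / q%:R.

Lemma block_cdfS (q s t : nat) : (0 < q)%N ->
  block_cdf q s t.+1 - block_cdf q s t = block_density q s t.
Proof.
by move=> q0; rewrite /block_cdf block_step// natrD mulrDl addrAC subrr add0r.
Qed.

Lemma block_cdf0 (q s : nat) : block_cdf q s 0 = 0.
Proof. by rewrite /block_cdf sub0n minn0 mul0r. Qed.

Lemma block_cdf_left (q s t : nat) : (t <= s %/ q * q)%N -> block_cdf q s t = 0.
Proof. by move=> /eqP tq; rewrite /block_cdf tq minn0 mul0r. Qed.

Lemma block_cdf_right (q s t : nat) : (0 < q)%N -> ((s %/ q).+1 * q <= t)%N ->
  block_cdf q s t = 1.
Proof.
move=> q0; rewrite mulSn => qt; rewrite /block_cdf (minn_idPl _) ?divff//.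
  by rewrite pnatr_eq0 -lt0n.
by lia.
Qed.

Lemma block_cdf_ge0 (q s t : nat) : 0 <= block_cdf q s t.
Proof. by rewrite divr_ge0. Qed.

Lemma block_cdf_le1 (q s t : nat) : block_cdf q s t <= 1.
Proof.
case: q => [|q]; first by rewrite /block_cdf min0n mul0r.
by rewrite ler_pdivrMr ?ltr0n// mul1r ler_nat geq_minl.
Qed.

Lemma block_density_ge0 (q s t : nat) : 0 <= block_density q s t.
Proof. by rewrite divr_ge0. Qed.

Lemma block_cdf_diff_eq0 (q r s t : nat) : (0 < q)%N -> (0 < r)%N ->
  (t %/ (r * q) != s %/ (r * q))%N ->
  block_cdf q s t - block_cdf (r * q) s t = 0.
Proof.
move=> q0 r0; have [sl sr] := block_nested s q0 r0.
have rq0 : (0 < r * q)%N by rewrite muln_gt0 r0.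
rewrite neq_ltn => /orP[|].
  rewrite ltn_divLR// => /ltnW ts; rewrite !block_cdf_left ?subr0//.
  exact: leq_trans sl.
rewrite leq_divRL// => st; rewrite !block_cdf_right ?subrr//.
exact: leq_trans st.
Qed.

Lemma block_cdf_diff_le1 (q q' s t : nat) :
  `|block_cdf q s t - block_cdf q' s t| <= 1.
Proof.
have := block_cdf_ge0 q s t; have := block_cdf_ge0 q' s t.
have := block_cdf_le1 q s t; have := block_cdf_le1 q' s t.
by rewrite ler_norml; lra.
Qed.

End block.

(** The factors [alpha j] are replaced by [beta j] one index at a time. *)
Lemma telescope_prod (R : realType) (d : nat) (alpha beta : 'I_d -> R) :
  \sum_(i < d) (\prod_(j < d | j != i) (if (j < i)%N then beta j else alpha j)) *
     (alpha i - beta i) = \prod_j alpha j - \prod_j beta j.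
Proof.
pose w (k : nat) := \prod_(j < d) (if (j < k)%N then beta j else alpha j).
transitivity (\sum_(i < d) - (w i.+1 - w i)).
  apply: eq_bigr => i _; rewrite opprB mulrBr /w.
  rewrite [X in _ = X - _](bigD1 i)//= ltnn.
  rewrite [X in _ = _ - X](bigD1 i)//= ltnSn.
  rewrite [alpha i * _]mulrC [beta i * _]mulrC; congr (_ - _ * _).
  by apply: eq_bigr => j ji; rewrite ltnS (leq_eqVlt j) (negPf ji : (j == i :> nat) = false).
rewrite sumrN -(big_mkord xpredT (fun i => w i.+1 - w i)) telescope_sumr//= opprB.
by congr (_ - _); apply: eq_bigr => j _; rewrite ?ltn_ord.
Qed.

Section flux.
Context {R : realType} (B K d : nat).

(** Flow along coordinate [i] at scale [m], when the uniform probability on the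
cube of side [B ^ m] around [z] is spread over the cube of side [B ^ m.+1].
Coordinates [j < i] have already been spread.  The flow crosses the boundary
between [t - 1] and [t] on the line through [x] in direction [i]; in one
dimension it is the difference of the two distribution functions. *)
Definition flux_level (m : nat) (i : 'I_d) (z x : 'I_d -> nat) (t : nat) : R :=
  (\prod_(j < d | j != i) block_density (B ^ (if (j < i)%N then m.+1 else m)) (z j) (x j)) *
  (block_cdf (B ^ m) (z i) t - block_cdf (B ^ m.+1) (z i) t).

Definition flux (i : 'I_d) (z x : 'I_d -> nat) (t : nat) : R :=
  \sum_(m < K) flux_level m i z x t.

(** The bound on [flux_level m]: unit flow spread over the [(B ^ m) ^ d.-1]
lines of a cube of side [B ^ m]. *)
Definition level_weight (m : nat) : R := (B ^ m)%:R ^- d.-1.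

Lemma eq_flux (i : 'I_d) (z x x' : 'I_d -> nat) (t : nat) :
  (forall j, j != i -> x j = x' j) -> flux i z x t = flux i z x' t.
Proof.
move=> xx'; apply: eq_bigr => m _; congr (_ * _).
by apply: eq_bigr => j /xx' ->.
Qed.

Hypothesis B0 : (0 < B)%N.

Lemma flux0 (i : 'I_d) (z x : 'I_d -> nat) : flux i z x 0 = 0.
Proof.
by rewrite /flux big1// => m _; rewrite /flux_level !block_cdf0 subrr mulr0.
Qed.

Lemma fluxN (i : 'I_d) (z x : 'I_d -> nat) :
  (z i < B ^ K)%N -> flux i z x (B ^ K) = 0.
Proof.
move=> zi; rewrite /flux big1// => m _; rewrite /flux_level.
have H k : (k <= K)%N -> block_cdf (B ^ k) (z i) (B ^ K) = 1 :> R.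
  move=> kK; apply: block_cdf_right; rewrite ?expn_gt0 ?B0//.
  rewrite -leq_divRL ?expn_gt0 ?B0// ltn_divLR ?expn_gt0 ?B0//.
  by rewrite divnK// dvdn_exp2l.
by rewrite !H ?subrr ?mulr0// ltnW.
Qed.

(** The total flow carries the point mass at [z] to the uniform probability on
the grid of side [B ^ K]: the increments of [flux_level] in direction [i] are
the differences of [telescope_prod], and the scales telescope in turn. *)
Lemma flux_div (z x : 'I_d -> nat) :
  (forall j, (z j < B ^ K)%N) -> (forall j, (x j < B ^ K)%N) ->
  \sum_i (flux i z x (x i).+1 - flux i z x (x i)) =
  [forall j, x j == z j]%:R - (B ^ K)%:R ^- d.
Proof.
move=> zN xN.
pose D m := \prod_j (block_density (B ^ m) (z j) (x j) : R).
transitivity (\sum_(m < K) - (D m.+1 - D m)).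
  under eq_bigr do rewrite /flux -sumrB.
  rewrite exchange_big /=; apply: eq_bigr => m _; rewrite opprB -telescope_prod.
  apply: eq_bigr => i _; rewrite /flux_level -mulrBr; congr (_ * _).
    by apply: eq_bigr => j _; case: ifP.
  rewrite opprB addrACA [- _ + _]addrC -opprB opprK addrC.
  rewrite -!block_cdfS ?expn_gt0 ?B0//; ring.
rewrite sumrN -(big_mkord xpredT (fun i => D i.+1 - D i)) telescope_sumr//= opprB.
congr (_ - _).
  rewrite /D; have [/forallP xz|] := boolP [forall j, x j == z j].
    rewrite big1// => j _; rewrite /block_density expn0 !divn1 xz divff//.
    by rewrite oner_eq0.
  rewrite negb_forall => /existsP[j xzj].
  by rewrite (bigD1 j)//= /block_density expn0 !divn1 (negPf xzj) !mul0r.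
rewrite /D (eq_bigr (fun=> (B ^ K)%:R^-1)) => [|j _].
  by rewrite prodr_const card_ord exprVn.
by rewrite /block_density !divn_small ?eqxx ?mul1r.
Qed.

(** The flow at scale [m] vanishes unless the boundary lies in the cube of side
[B ^ m.+1] around [z]; for the crossing coordinate this holds because the two
distribution functions agree outside the larger block. *)
Lemma flux_level_le (m : nat) (i : 'I_d) (z x : 'I_d -> nat) (t : nat) :
  `|flux_level m i z x t| <= level_weight m *
   [forall j, ((if j == i then t else x j) %/ B ^ m.+1 == z j %/ B ^ m.+1)%N]%:R.
Proof.
have [/forallP H|] :=
    boolP [forall j, ((if j == i then t else x j) %/ B ^ m.+1 == z j %/ B ^ m.+1)%N].
  rewrite mulr1 /flux_level normrM -[leRHS]mulr1.
  apply: ler_pM; rewrite ?normr_ge0 ?block_cdf_diff_le1//.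
  rewrite normr_prod /level_weight -exprVn.
  have -> : (B ^ m)%:R^-1 ^+ d.-1 = \prod_(j | j != i) (B ^ m)%:R^-1 :> R.
    by rewrite prodr_const (cardC1 i) card_ord.
  apply: ler_prod => j ji; rewrite normr_ge0/= ger0_norm ?block_density_ge0//.
  apply: (@le_trans _ _ (B ^ (if (j < i)%N then m.+1 else m))%:R^-1).
    rewrite /block_density -[leRHS]mul1r ler_wpM2r ?invr_ge0//.
    by case: eqP.
  rewrite lef_pV2 ?posrE ?ltr0n ?expn_gt0 ?B0// ler_nat leq_pexp2l//.
  by case: ifP.
rewrite negb_forall => /existsP[j]; rewrite mulr0 expnS.
have Bm0 : (0 < B ^ m)%N by rewrite expn_gt0 B0.
have [->|ji] := eqVneq j i => Hj.
  by rewrite /flux_level expnS block_cdf_diff_eq0// mulr0 normr0.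
rewrite /flux_level (bigD1 j)//= (_ : block_density _ _ _ = 0) ?mul0r ?normr0//.
rewrite /block_density; case: eqP; rewrite ?mul0r//.
case: ifP => _; rewrite ?expnS => E; first by rewrite E eqxx in Hj.
by move: Hj; rewrite [(B * _)%N]mulnC !divnMA E eqxx.
Qed.

Lemma sum_block_le (q N : nat) (v : 'I_d -> nat) : (0 < q)%N ->
  \sum_(z : {ffun 'I_d -> 'I_N}) [forall j, (v j %/ q == z j %/ q)%N]%:R <=
  (q ^ d)%:R :> R.
Proof.
move=> q0.
under eq_bigr => z _.
  rewrite (_ : _%:R = \prod_j (z j %/ q == v j %/ q)%N%:R); last first.
    have [/forallP H|] := boolP [forall j, (v j %/ q == z j %/ q)%N].
      by rewrite big1// => j _; rewrite eq_sym H.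
    rewrite negb_forall => /existsP[j /negPf vz].
    by rewrite (bigD1 j)//= eq_sym vz mul0r.
  over.
rewrite -(bigA_distr_bigA (fun j (t : 'I_N) => (t %/ q == v j %/ q)%N%:R)) /=.
rewrite natrX -[d in leRHS]card_ord -prodr_const.
apply: ler_prod => j _; rewrite sumr_ge0//=.
rewrite -natr_sum ler_nat -(big_mkord xpredT (fun t => (t %/ q == v j %/ q)%N : nat)).
suff -> : (\sum_(0 <= t < N) (t %/ q == v j %/ q) = minn q (N - v j %/ q * q))%N.
  exact: geq_minl.
elim: N => [|N IH]; first by rewrite big_geq// sub0n minn0.
by rewrite big_nat_recr//= IH -block_step.
Qed.

(** For weights with tails comparable to their first term, a sum over a set of
scales is comparable to its term at the smallest scale, hence its square to the
sum of squares.  This avoids the loss of the triangle inequality in [L^2]. *)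
Lemma sum_weights_sqr_le (w : nat -> R) (E : nat -> bool) :
  (forall m, 0 <= w m) ->
  (forall m, (m < K)%N -> \sum_(m <= l < K) w l <= 2 * w m) ->
  (\sum_(m < K) w m * (E m)%:R) ^+ 2 <= 4 * \sum_(m < K) w m ^+ 2 * (E m)%:R.
Proof.
move=> w0 wtail.
have wE0 m : 0 <= w m * (E m)%:R by rewrite mulr_ge0.
have [/existsP[k Ek]|/existsPn noE] := boolP [exists m : 'I_K, E m]; last first.
  rewrite big1 => [|m _]; last by rewrite (negPf (noE m)) mulr0.
  rewrite expr0n mulr_ge0// sumr_ge0// => m _.
  by rewrite mulr_ge0// exprn_ge0.
have ex : exists m, E m && (m < K)%N by exists k; rewrite Ek ltn_ord.
pose m0 := ex_minn ex; have /andP[Em0 m0K] : E m0 && (m0 < K)%N.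
  by rewrite /m0; case: ex_minnP.
have m0min m : (m < m0)%N -> (m < K)%N -> E m = false.
  move=> mm0 mK; apply/negP => Em; move: mm0; rewrite /m0; case: ex_minnP => l _.
  by move=> /(_ m); rewrite Em mK leqNgt => /(_ isT)/negP.
have le2 : \sum_(m < K) w m * (E m)%:R <= 2 * w m0.
  apply: le_trans (wtail _ m0K).
  rewrite -(big_mkord xpredT (fun m => w m * (E m)%:R)).
  rewrite (big_cat_nat (n := m0))//=; last exact: ltnW.
  rewrite big_nat_cond big1 ?add0r.
    by apply: ler_sum => m _; rewrite ler_piMr// lern1 leq_b1.
  by move=> m /andP[/andP[_ mm0] _]; rewrite m0min ?mulr0// (ltn_trans mm0).
apply: (@le_trans _ _ ((2 * w m0) ^+ 2)).
  by rewrite lerXn2r ?nnegrE ?sumr_ge0// mulr_ge0.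
rewrite exprMn (_ : 2 ^+ 2 = 4 :> R) -?natrX// ler_wpM2l//.
rewrite (bigD1 (Ordinal m0K))//= Em0 mulr1 lerDl sumr_ge0// => m _.
by rewrite mulr_ge0// exprn_ge0.
Qed.

Lemma level_weight_ge0 m : 0 <= level_weight m.
Proof. by rewrite invr_ge0 exprn_ge0. Qed.

Hypothesis tail : forall m, (m < K)%N ->
  \sum_(m <= l < K) level_weight l <= 2 * level_weight m.

Lemma flux_le2 (i : 'I_d) (z x : 'I_d -> nat) (t : nat) : `|flux i z x t| <= 2.
Proof.
have [K0|K0] := eqVneq K 0%N.
  by rewrite /flux big1 ?normr0// => -[m mK]; exfalso; rewrite K0 in mK.
apply: (@le_trans _ _ (\sum_(0 <= m < K) level_weight m)).
  rewrite big_mkord (le_trans (ler_norm_sum _ _ _))//.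
  apply: ler_sum => m _; apply: (le_trans (flux_level_le _ _ _ _ _)).
  by rewrite ler_piMr ?level_weight_ge0// lern1 leq_b1.
rewrite (le_trans (tail _)) ?lt0n// /level_weight expn0 expr1n invr1 mulr1//.
Qed.

(** The second moment of the kernel for [z] uniform on the grid, before
normalization. *)
Lemma sum_flux_sqr_le (N : nat) (i : 'I_d) (x : 'I_d -> nat) (t : nat) :
  \sum_(z : {ffun 'I_d -> 'I_N}) flux i (fun j => z j) x t ^+ 2 <=
  4 * \sum_(m < K) level_weight m ^+ 2 * ((B ^ m.+1) ^ d)%:R.
Proof.
pose E (z : {ffun 'I_d -> 'I_N}) m := 
  [forall j, ((if j == i then t else x j) %/ B ^ m.+1 == z j %/ B ^ m.+1)%N].
apply: (@le_trans _ _ (\sum_z 4 * \sum_(m < K) level_weight m ^+ 2 * (E z m)%:R)).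
  apply: ler_sum => z _.
  apply: le_trans (sum_weights_sqr_le _ level_weight_ge0 tail).
  rewrite -[leLHS]real_normK ?num_real// lerXn2r ?nnegrE ?sumr_ge0//.
    by move=> m _; rewrite mulr_ge0 ?level_weight_ge0.
  by rewrite (le_trans (ler_norm_sum _ _ _))// ler_sum// => m _; apply: flux_level_le.
rewrite -mulr_sumr ler_wpM2l// exchange_big /= ler_sum// => m _.
rewrite -mulr_sumr ler_wpM2l ?exprn_ge0 ?level_weight_ge0//.
by apply: sum_block_le; rewrite expn_gt0 B0.
Qed.

End flux.

(** * Moments of sums of independent variables *)

(** Expectation of [F] under the [n]-fold product of the weights [a]. *)
Definition iid_mean (R : realType) (G : finType) (a : G -> R) (n : nat)
    (F : {ffun 'I_n -> G} -> R) : R :=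
  \sum_(y : {ffun 'I_n -> G}) (\prod_j a (y j)) * F y.

Definition ffun_cons (G : finType) (n : nat) (g : G) (y : {ffun 'I_n -> G}) :
    {ffun 'I_n.+1 -> G} :=
  [ffun i => if unlift ord0 i is Some j then y j else g].

Lemma ffun_cons0 (G : finType) (n : nat) (g : G) (y : {ffun 'I_n -> G}) :
  ffun_cons g y ord0 = g.
Proof. by rewrite ffunE unlift_none. Qed.

Lemma ffun_consS (G : finType) (n : nat) (g : G) (y : {ffun 'I_n -> G}) j :
  ffun_cons g y (lift ord0 j) = y j.
Proof. by rewrite ffunE liftK. Qed.

Lemma iid_mean_cons (R : realType) (G : finType) (a : G -> R) (n : nat)
    (F : {ffun 'I_n.+1 -> G} -> R) :
  iid_mean a F = \sum_g a g * iid_mean a (fun y => F (ffun_cons g y)).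
Proof.
rewrite /iid_mean; under [RHS]eq_bigr do rewrite mulr_sumr.
rewrite pair_big /= (reindex (fun p => ffun_cons p.1 p.2)) /=; last first.
  exists (fun y : {ffun 'I_n.+1 -> G} => (y ord0, [ffun j => y (lift ord0 j)])).
    move=> [g y] _ /=; rewrite ffun_cons0; congr pair.
    by apply/ffunP => j; rewrite ffunE ffun_consS.
  move=> y _ /=; apply/ffunP => i; rewrite ffunE.
  by case: unliftP => [j ->|->]; rewrite ?ffunE.
apply: eq_bigr => -[g y] _ /=; rewrite big_ord_recl ffun_cons0 -mulrA.
by congr (_ * (_ * _)); apply: eq_bigr => j _; rewrite ffun_consS.
Qed.

Section iid_mean_linear.
Context {R : realType} {G : finType} (a : G -> R) (n : nat).
Implicit Types F H : {ffun 'I_n -> G} -> R.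

Lemma iid_meanD F H : iid_mean a (fun y => F y + H y) = iid_mean a F + iid_mean a H.
Proof. by rewrite /iid_mean -big_split; apply: eq_bigr => y _; rewrite mulrDr. Qed.

Lemma iid_meanZ c F : iid_mean a (fun y => c * F y) = c * iid_mean a F.
Proof. by rewrite /iid_mean mulr_sumr; apply: eq_bigr => y _; rewrite mulrCA. Qed.

Lemma iid_mean_sum (I : Type) (r : seq I) (P : pred I) (F : I -> {ffun 'I_n -> G} -> R) :
  iid_mean a (fun y => \sum_(i <- r | P i) F i y) = \sum_(i <- r | P i) iid_mean a (F i).
Proof.
by rewrite /iid_mean exchange_big /=; apply: eq_bigr => y _; rewrite mulr_sumr.
Qed.

Lemma le_iid_mean F H : (forall g, 0 <= a g) -> (forall y, F y <= H y) ->
  iid_mean a F <= iid_mean a H.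
Proof.
move=> a0 FH; apply: ler_sum => y _; apply: ler_wpM2l => //.
exact: prodr_ge0.
Qed.

Lemma iid_mean_cst c : \sum_g a g = 1 -> iid_mean a (fun _ : {ffun 'I_n -> G} => c) = c.
Proof.
move=> a1; rewrite /iid_mean -mulr_suml -(bigA_distr_bigA (fun=> a)) /=.
by rewrite a1 big1 ?mul1r.
Qed.

End iid_mean_linear.

(** Rosenthal's inequality for even exponents and bounded variables, by
induction on the number of summands: [expr_second_order] bounds the increment of
the moment, its linear term is centred, and Young's inequality bounds
[v * E S ^ m] by [n^-1 * (E S ^ m.+2 + (n v) ^ r.+1)], so that [n] steps cost
a constant factor. *)
Lemma iid_moment (R : realType) (G : finType) (a phi : G -> R) (r n : nat)
    (beta v : R) :
  (0 < n)%N -> (forall g, 0 <= a g) -> \sum_g a g = 1 ->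
  \sum_g a g * phi g = 0 -> \sum_g a g * phi g ^+ 2 <= v ->
  (forall g, `|phi g| <= beta) ->
  iid_mean a (fun y : {ffun 'I_n -> G} => (\sum_j phi (y j)) ^+ r.*2.+2) <=
  expR (2 ^+ r.*2.+2) * ((n%:R * v) ^+ r.+1 + n%:R * v * beta ^+ r.*2).
Proof.
move=> n0 a0 a1 aphi0 av phib; set m := r.*2; set A := _ + _.
have nR0 : 0 < n%:R :> R by rewrite ltr0n.
have v0 : 0 <= v.
  by apply: le_trans av; apply: sumr_ge0 => g _; rewrite mulr_ge0// exprn_even_ge0.
have b0 : 0 <= beta ^+ m by rewrite /m -mul2n exprM exprn_ge0// exprn_even_ge0.
have nv0 : 0 <= n%:R * v by rewrite mulr_ge0.
have A0 : 0 <= A by exact: addr_ge0 (exprn_ge0 _ nv0) (mulr_ge0 nv0 b0).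
have meven (x : R) k : 0 <= x ^+ (k.*2).
  by rewrite -mul2n exprM exprn_ge0// exprn_even_ge0.
have H k : iid_mean a (fun y : {ffun 'I_k -> G} => (\sum_j phi (y j)) ^+ m.+2) + A
    <= A * expR (k%:R * (2 ^+ m.+2 / n%:R)).
  elim: k => [|k IH].
    rewrite mul0r expR0 mulr1 gerDr /iid_mean big1// => y _.
    by rewrite !big_ord0 expr0n mulr0.
  have -> : k.+1%:R * (2 ^+ m.+2 / n%:R) =
      k%:R * (2 ^+ m.+2 / n%:R) + 2 ^+ m.+2 / n%:R :> R by rewrite -natr1; ring.
  rewrite expRD mulrA; apply: gronwall_step IH _.
    apply: addr_ge0 => //; apply: sumr_ge0 => y _; apply: mulr_ge0.
      exact: prodr_ge0.
    exact: (meven _ r.+1).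
  rewrite iid_mean_cons.
  pose S (y : {ffun 'I_k -> G}) := \sum_j phi (y j).
  rewrite -/S; set u := iid_mean a (fun y => S y ^+ m.+2).
  apply: (@le_trans _ _ (\sum_g a g * (u +
      m.+2%:R * phi g * iid_mean a (fun y => S y ^+ m.+1) +
      2 ^+ m.+2 * phi g ^+ 2 * (iid_mean a (fun y => S y ^+ m) + beta ^+ m)))).
    apply: ler_sum => g _; apply: ler_wpM2l => //.
    rewrite -iid_meanZ -[beta ^+ m in leRHS](iid_mean_cst k _ a1) -!iid_meanD.
    rewrite -iid_meanZ -iid_meanD; apply: le_iid_mean => // y.
    rewrite big_ord_recl ffun_cons0; under eq_bigr do rewrite ffun_consS.
    rewrite -/(S y) addrC (le_trans (expr_second_order _ _ _))//.
    rewrite [X in _ + X + _ <= _]mulrAC lerD2l -[leRHS]mulrA ler_wpM2l ?exprn_ge0//.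
    rewrite mulrDr [_ * S y ^+ m]mulrC real_normK ?num_real//.
    have -> : `|S y| ^+ m = S y ^+ m.
      by rewrite -normrX ger0_norm// meven.
    rewrite lerD2l -addn2 exprD real_normK ?num_real// mulrC.
    by rewrite ler_wpM2l ?exprn_even_ge0// lerXn2r ?nnegrE// (le_trans _ (phib g)).
  under eq_bigr do rewrite !mulrDr.
  rewrite !big_split /= -mulr_suml a1 mul1r.
  have -> : \sum_g a g * (m.+2%:R * phi g * iid_mean a (fun y => S y ^+ m.+1)) = 0.
    transitivity (m.+2%:R * iid_mean a (fun y => S y ^+ m.+1) * \sum_g a g * phi g);
      last by rewrite aphi0 mulr0.
    by rewrite mulr_sumr; apply: eq_bigr => g _; ring.
  rewrite addr0 lerD2l -big_split /=.
  set T := iid_mean a _; set B := beta ^+ m.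
  have T0 : 0 <= T.
    apply: sumr_ge0 => y _; apply: mulr_ge0; last exact: meven.
    exact: prodr_ge0.
  have -> : \sum_g (a g * (2 ^+ m.+2 * phi g ^+ 2 * T) + a g * (2 ^+ m.+2 * phi g ^+ 2 * B)) =
      2 ^+ m.+2 * ((T + B) * \sum_g a g * phi g ^+ 2).
    by rewrite !mulr_sumr; apply: eq_bigr => g _; ring.
  rewrite -[leRHS]mulrA ler_wpM2l ?exprn_ge0// ler_pdivlMl//.
  apply: (@le_trans _ _ (n%:R * ((T + B) * v))).
    rewrite ler_wpM2l// ler_wpM2l//; exact: addr_ge0.
  have -> : n%:R * ((T + B) * v) = n%:R * v * T + n%:R * v * B by ring.
  rewrite /A addrA lerD2r -iid_meanZ -[_ ^+ r.+1](iid_mean_cst k _ a1) -iid_meanD.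
  apply: le_iid_mean => // y; rewrite -/(S y).
  have := @young_expr R r (n%:R * v) (S y ^+ 2) 1 nv0.
  rewrite exprn_even_ge0// => /(_ isT ltr01); rewrite expr1n divr1 mul1r.
  by rewrite -!exprM mulnC muln2 mul2n doubleS addrC.
apply: (@le_trans _ _ (A * expR (n%:R * (2 ^+ m.+2 / n%:R)))).
  by apply: le_trans (H n); rewrite lerDl.
by rewrite mulrC [n%:R * _]mulrC divfK// gt_eqF.
Qed.

(** * Transport on the grid *)

Section grid.
Context {R : realType} {d N : nat}.
Local Notation G := {ffun 'I_d -> 'I_N}.

(** The l1 distance on [{0, ..., N - 1} ^ d], in units of the side of a cell and
without wrapping around. *)
Definition grid_dist (x y : G) : R := \sum_j `|(x j)%:R - (y j)%:R|.

Definition grid_succ (i : 'I_d) (x y : G) : bool :=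
  [forall j, (y j == (if j == i then (x i).+1 else x j) :> nat)].

Lemma grid_succP (i : 'I_d) (x y : G) :
  reflect (y i = (x i).+1 :> nat /\ forall j, j != i -> y j = x j) (grid_succ i x y).
Proof.
apply: (iffP forallP) => [H|[yi yj] j].
  split=> [|j ji]; first by have /eqP := H i; rewrite eqxx.
  by apply: val_inj => /=; have /eqP := H j; rewrite (negPf ji).
by case: (eqVneq j i) => [->|ji]; [rewrite yi|rewrite yj].
Qed.

Definition grid_set (i : 'I_d) (x : G) (t : nat) : G :=
  [ffun j => if j == i then insubd (x i) t else x j].

Lemma grid_succ_next (i : 'I_d) (x y : G) : ((x i).+1 < N)%N ->
  grid_succ i x y = (y == grid_set i x (x i).+1).
Proof.
move=> xN; apply/grid_succP/eqP => [[yi yj]|->].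
  apply/ffunP => j; rewrite ffunE; case: eqVneq => [->|/yj//].
  by apply: val_inj; rewrite val_insubd xN.
split=> [|j ji]; rewrite ffunE ?eqxx ?val_insubd ?xN//.
by rewrite (negPf ji).
Qed.

Lemma grid_succ_prev (i : 'I_d) (x y : G) : (0 < x i)%N ->
  grid_succ i y x = (y == grid_set i x (x i).-1).
Proof.
move=> x0; have xN : ((x i).-1 < N)%N by rewrite (leq_ltn_trans (leq_pred _)).
apply/grid_succP/eqP => [[yi yj]|->].
  apply/ffunP => j; rewrite ffunE; case: eqVneq => [->|/yj//].
  by apply: val_inj; rewrite val_insubd xN yi.
split=> [|j ji]; rewrite ffunE ?eqxx ?val_insubd ?xN ?prednK//.
by rewrite (negPf ji).
Qed.

(** The side condition on [c] says that nothing leaves through the outer faces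
of the grid. *)
Lemma sum_grid_next (i : 'I_d) (x : G) (c : R) : ((x i).+1 = N -> c = 0) ->
  \sum_y (grid_succ i x y)%:R * c = c.
Proof.
move=> cN; have [xN|] := ltnP (x i).+1 N.
  rewrite (bigD1 (grid_set i x (x i).+1))//= grid_succ_next// eqxx mul1r.
  by rewrite big1 ?addr0// => y /negPf yx; rewrite grid_succ_next// yx mul0r.
move=> Nx; have /cN -> : (x i).+1 = N by apply/eqP; rewrite eqn_leq ltn_ord Nx.
by rewrite big1// => y _; rewrite mulr0.
Qed.

Lemma sum_grid_prev (i : 'I_d) (x : G) (h : G -> R) (c : R) :
  (forall y, grid_succ i y x -> h y = c) -> (x i = 0%N :> nat -> c = 0) ->
  \sum_y (grid_succ i y x)%:R * h y = c.
Proof.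
move=> hc c0; have [xi|xi] := posnP (x i).
  rewrite (c0 xi) big1// => y _; case: grid_succP => [[]|_]; last by rewrite mul0r.
  by rewrite xi.
have H := grid_succ_prev _ xi.
rewrite (bigD1 (grid_set i x (x i).-1))//= H eqxx mul1r hc ?H//.
by rewrite big1 ?addr0// => y /negPf yx; rewrite H yx mul0r.
Qed.

Lemma grid_dist_refl (x : G) : grid_dist x x = 0.
Proof. by rewrite /grid_dist big1// => j _; rewrite subrr normr0. Qed.

Lemma grid_dist_ge0 (x y : G) : 0 <= grid_dist x y.
Proof. exact: sumr_ge0. Qed.

Lemma grid_dist_le (x y : G) : grid_dist x y <= (d * N)%:R.
Proof.
rewrite -[d in leRHS]card_ord -sum_nat_const natr_sum ler_sum// => j _.
have xN : (x j)%:R <= N%:R :> R by rewrite ler_nat ltnW.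
have yN : (y j)%:R <= N%:R :> R by rewrite ler_nat ltnW.
have x0 : 0 <= (x j)%:R :> R by [].
have y0 : 0 <= (y j)%:R :> R by [].
by rewrite ler_norml; apply/andP; split; lra.
Qed.

Lemma grid_dist_succ (i : 'I_d) (x y z : G) : grid_succ i y z || grid_succ i z y ->
  grid_dist x z <= grid_dist x y + 1.
Proof.
move=> yz; rewrite /grid_dist (bigD1 i)//= [X in _ <= X + 1](bigD1 i)//= addrAC.
have yzj j : j != i -> y j = z j.
  by case/orP: yz => /grid_succP[_ H] ji; rewrite H.
rewrite lerD//; last by apply: ler_sum => j /yzj ->.
have yzi : `|(y i)%:R - (z i)%:R| <= 1 :> R.
  case/orP: yz => /grid_succP[-> _]; rewrite -natr1 ler_norml; apply/andP; split; lra.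
by rewrite (le_trans (ler_distD (y i)%:R _ _))// lerD2l.
Qed.

End grid.

(** Crude power mean inequality, by comparison with the largest term. *)
Lemma sum_expr_le (R : realFieldType) (I : finType) (t : I -> R) (m : nat) :
  (forall i, 0 <= t i) -> (\sum_i t i) ^+ m.+1 <= #|I|%:R ^+ m.+1 * \sum_i t i ^+ m.+1.
Proof.
move=> t0; have [i0 _|noI] := pickP (@predT I); last first.
  rewrite [X in X ^+ _]big_pred0// expr0n mulr_ge0 ?exprn_ge0// sumr_ge0// => i _.
  exact: exprn_ge0.
pose k := [arg max_(i > i0) t i]%O.
have tk i : t i <= t k by rewrite /k; case: arg_maxP => // j _; apply.
apply: (@le_trans _ _ ((#|I|%:R * t k) ^+ m.+1)).
  rewrite lerXn2r ?nnegrE ?sumr_ge0 ?mulr_ge0//.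
  by rewrite mulr_natl -sumr_const ler_sum.
rewrite exprMn ler_wpM2l ?exprn_ge0// (bigD1 k)//= lerDl sumr_ge0// => i _.
exact: exprn_ge0.
Qed.

Section grid_flow.
Context {R : realType} (B K d : nat).
Hypothesis B0 : (0 < B)%N.
Local Notation N := (B ^ K)%N.
Local Notation G := {ffun 'I_d -> 'I_N}.

(** Superposition of the flows that spread the point masses [h z]. *)
Definition grid_flux (h : G -> R) (i : 'I_d) (x : G) (t : nat) : R :=
  \sum_z h z * flux B K i (fun j => z j) (fun j => x j) t.

Lemma grid_flux_div (h : G -> R) (x : G) : \sum_z h z = 0 ->
  \sum_i (grid_flux h i x (x i).+1 - grid_flux h i x (x i)) = h x.
Proof.
move=> h0.
transitivity (\sum_z h z * ([forall j, x j == z j :> nat]%:R - (B ^ K)%:R ^- d)).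
  rewrite /grid_flux; under eq_bigr do rewrite -sumrB.
  rewrite exchange_big /=; apply: eq_bigr => z _.
  under eq_bigr do rewrite -mulrBr.
  rewrite -mulr_sumr (@flux_div R B K d B0 (fun j => z j) (fun j => x j))//.
under eq_bigr do rewrite mulrBr.
rewrite sumrB -[X in _ - X]mulr_suml h0 mul0r subr0 (bigD1 x)//= big1 ?addr0.
  rewrite (_ : [forall j, _]) ?mulr1//.
  by apply/forallP.
move=> z zx; rewrite (_ : [forall j, _] = false) ?mulr0//.
apply/negbTE; apply: contra zx => /forallP H; apply/eqP/ffunP => j.
by apply: val_inj => /=; rewrite (eqP (H j)).
Qed.

(** [flow_coupling] for the flow [grid_flux] of [a - b]: positive parts run in
the positive directions and negative parts backwards.  In the index [k], the
boolean selects the upper or the lower face of the cell [x]. *)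
Lemma grid_coupling (a b : G -> R) (p : nat) :
  (forall x, 0 < a x) -> (forall x, 0 <= b x) ->
  \sum_x a x = 1 -> \sum_x b x = 1 ->
  exists pi : G -> G -> R, is_coupling pi a b /\
    transport_cost pi (fun x y => (1 + grid_dist x y) ^+ p.+1) <=
    (expR (3 ^+ p * p.+1%:R) + 1) *
    (1 + \sum_x (\sum_(k : 'I_d * bool)
       `|grid_flux (fun z => a z - b z) k.1 x (x k.1 + k.2)|) ^+ p.+1 / a x ^+ p).
Proof.
move=> a0 b0 a1 b1; pose g := grid_flux (fun z => a z - b z).
have g0 i x : g i x 0 = 0.
  by rewrite /g /grid_flux big1// => z _; rewrite flux0 mulr0.
have gN i x : g i x N = 0.
  by rewrite /g /grid_flux big1// => z _; rewrite fluxN ?mulr0.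
have gsucc i x y : grid_succ i y x -> g i y (y i).+1 = g i x (x i).
  move=> /grid_succP[-> yx]; apply: eq_bigr => z _; congr (_ * _).
  by apply: eq_flux => j ji; rewrite yx.
pose gp i x t := Num.max (g i x t) 0.
pose gn i x t := Num.max (- g i x t) 0.
have gp0 i x t : 0 <= gp i x t by rewrite le_max lexx orbT.
have gn0 i x t : 0 <= gn i x t by rewrite le_max lexx orbT.
have gpn i x t : gp i x t - gn i x t = g i x t.
  by rewrite /gp /gn; case: (leP (g i x t) 0); case: (leP (- g i x t) 0); lra.
have gple i x t : gp i x t <= `|g i x t| by rewrite ge_max ler_norm normr_ge0.
have gnle i x t : gn i x t <= `|g i x t|.
  by rewrite ge_max normr_ge0 andbT -normrN ler_norm.
(* A negative flow from [y] to its successor [x] runs from [x] to [y]. *)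
pose f x y := \sum_i ((grid_succ i x y)%:R * gp i x (x i).+1 +
                      (grid_succ i y x)%:R * gn i y (y i).+1).
have f0 x y : 0 <= f x y.
  by rewrite sumr_ge0// => i _; rewrite addr_ge0// mulr_ge0.
have fout x : \sum_y f x y = \sum_i (gp i x (x i).+1 + gn i x (x i)).
  rewrite exchange_big /=; apply: eq_bigr => i _; rewrite big_split /=; congr (_ + _).
    by apply: sum_grid_next => xN; rewrite /gp xN gN maxxx.
  apply: sum_grid_prev => [y yx|xi]; first by rewrite /gn (gsucc _ _ _ yx).
  by rewrite /gn xi g0 oppr0 maxxx.
have fin x : \sum_y f y x = \sum_i (gp i x (x i) + gn i x (x i).+1).
  rewrite exchange_big /=; apply: eq_bigr => i _; rewrite big_split /=; congr (_ + _).
    apply: sum_grid_prev => [y yx|xi]; first by rewrite /gp (gsucc _ _ _ yx).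
    by rewrite /gp xi g0 maxxx.
  by apply: sum_grid_next => xN; rewrite /gn xN gN oppr0 maxxx.
have fab y : b y - a y = \sum_x f x y - \sum_x f y x.
  rewrite fin fout -sumrB -opprB -(@grid_flux_div (fun z => a z - b z)); last first.
    by rewrite sumrB a1 b1 subrr.
  rewrite -sumrN; apply: eq_bigr => i _; rewrite -!/(g _ _ _) -!gpn; ring.
have frho x y z : f y z != 0 -> grid_dist x z <= grid_dist x y + 1 :> R.
  move=> fyz; have [/existsP[i yz]|/existsPn no] :=
      boolP [exists i, grid_succ i y z || grid_succ i z y].
    exact: grid_dist_succ yz.
  move: fyz; rewrite /f big1 ?eqxx// => i _.
  by have := no i; rewrite negb_or => /andP[/negPf-> /negPf->]; rewrite !mul0r addr0.
have rhoD (x y : G) : 0 <= (grid_dist x y : R) <= (d * N)%:R.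
  by rewrite grid_dist_ge0 grid_dist_le.
have [pi [piab picost]] :=
  flow_coupling p (@grid_dist_refl R d N) rhoD frho f0 a0 b0 a1 b1 fab.
exists pi; split=> //; apply: (le_trans picost).
rewrite ler_wpM2l ?addr_ge0 ?expR_ge0// lerD2l ler_sum// => x _.
rewrite ler_wpM2r ?invr_ge0 ?exprn_ge0 ?(ltW (a0 x))//.
rewrite lerXn2r ?nnegrE ?sumr_ge0//.
rewrite fout -(pair_bigA _ (fun i (c : bool) => `|g i x (x i + c)%N|)) /=.
apply: ler_sum => i _; rewrite big_bool /= addn1 addn0.
exact: lerD.
Qed.

End grid_flow.

(** * The empirical measure on the grid *)

Definition empirical_weight (R : realType) (G : finType) (n : nat)
    (y : {ffun 'I_n -> G}) (g : G) : R := n%:R^-1 * \sum_j (y j == g)%:R.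

Arguments empirical_weight {R G n}.

Lemma empirical_weight_ge0 (R : realType) (G : finType) (n : nat)
  (y : {ffun 'I_n -> G}) (g : G) : 0 <= empirical_weight y g :> R.
Proof. by rewrite mulr_ge0 ?invr_ge0 ?sumr_ge0. Qed.

Lemma sum_empirical_weight (R : realType) (G : finType) (n : nat)
    (y : {ffun 'I_n -> G}) (h : G -> R) :
  \sum_g empirical_weight y g * h g = n%:R^-1 * \sum_j h (y j).
Proof.
under eq_bigr do rewrite /empirical_weight -mulrA mulr_suml.
rewrite -mulr_sumr exchange_big /=; congr (_ * _); apply: eq_bigr => j _.
rewrite (bigD1 (y j))//= eqxx mul1r big1 ?addr0// => g.
by rewrite eq_sym => /negPf ->; rewrite mul0r.
Qed.

Lemma sum_empirical_weight1 (R : realType) (G : finType) (n : nat) : (0 < n)%N ->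
  forall y : {ffun 'I_n -> G}, \sum_g empirical_weight y g = 1 :> R.
Proof.
move=> n0 y; under eq_bigr do rewrite -[empirical_weight _ _]mulr1.
rewrite (sum_empirical_weight y (fun=> 1)) sumr_const card_ord mulVf//.
by rewrite pnatr_eq0 -lt0n.
Qed.

(** The product of the constants of [flow_coupling], of [sum_expr_le] over the
[2 d] faces of a cell, and of [iid_moment] for variables bounded by [4]. *)
Definition moment_constant (R : realType) (d r : nat) (fmin : R) : R :=
  (expR (3 ^+ r.*2.+1 * r.*2.+2%:R) + 1) *
  (1 + (d * 2)%:R ^+ r.*2.+3 / fmin ^+ r.*2.+1 *
    (expR (2 ^+ r.*2.+2) * (1 + 4 ^+ r.*2))).

Section grid_empirical.
Context {R : realType} (B K d : nat).
Hypothesis B0 : (0 < B)%N.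
Hypothesis tail : forall m, (m < K)%N ->
  \sum_(m <= l < K) level_weight B d l <= 2 * level_weight B d m :> R.
Local Notation N := (B ^ K)%N.
Local Notation G := {ffun 'I_d -> 'I_N}.

(** A bound for the Dirichlet energy of the kernel, see [sum_flux_sqr_le]. *)
Definition flux_energy : R :=
  4 * \sum_(m < K) level_weight B d m ^+ 2 * ((B ^ m.+1) ^ d)%:R.

Lemma flux_energy_ge0 : 0 <= flux_energy.
Proof.
by rewrite mulr_ge0// sumr_ge0// => m _; rewrite mulr_ge0// exprn_ge0// level_weight_ge0.
Qed.

(** By linearity the rescaled flow is a sum of centred i.i.d. variables [phi].
They are bounded by [4] because [N ^ d <= n], and [V] bounds the variance of the
sum, by [sum_flux_sqr_le] and the upper bound on the weights. *)
Lemma grid_flux_moment (r n : nat) (a : G -> R) (fmax V : R) (i : 'I_d) (x : G) (t : nat) :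
  (0 < n)%N -> (N ^ d <= n)%N -> (forall z, 0 <= a z) -> \sum_z a z = 1 ->
  (forall z, a z <= fmax / (N ^ d)%:R) ->
  V = (N ^ d)%:R * fmax * flux_energy / n%:R ->
  iid_mean a (fun y : {ffun 'I_n -> G} =>
    ((N ^ d)%:R * grid_flux (fun z => a z - empirical_weight y z) i x t) ^+ r.*2.+2) <=
  expR (2 ^+ r.*2.+2) * (V ^+ r.+1 + V * 4 ^+ r.*2).
Proof.
move=> n0 Nn a0 a1 amax VE.
have nR0 : 0 < n%:R :> R by rewrite ltr0n.
have Nd0 : 0 < (N ^ d)%:R :> R by rewrite ltr0n !expn_gt0 B0.
set Nd : R := (N ^ d)%:R in VE amax Nd0 *.
pose F (z : G) : R := flux B K i (fun j => z j) (fun j => x j) t.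
pose mean := \sum_z a z * F z.
pose phi z := Nd / n%:R * (mean - F z).
have gphi (y : {ffun 'I_n -> G}) :
    Nd * grid_flux (fun z => a z - empirical_weight y z) i x t = \sum_j phi (y j).
  rewrite -mulr_sumr sumrB sumr_const card_ord /grid_flux.
  under eq_bigr do rewrite mulrBl.
  rewrite sumrB sum_empirical_weight -/mean -mulr_natl -/F.
  by field; rewrite gt_eqF.
rewrite (_ : (fun y => _) =
    (fun y : {ffun 'I_n -> G} => (\sum_j phi (y j)) ^+ r.*2.+2)); last first.
  by apply/funext => y; rewrite gphi.
have F2 z : `|F z| <= 2 by exact: flux_le2.
have mean2 : `|mean| <= 2.
  apply: (@le_trans _ _ (\sum_z a z * 2)); last by rewrite -mulr_suml a1 mul1r.
  rewrite (le_trans (ler_norm_sum _ _ _))// ler_sum// => z _.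
  by rewrite normrM ger0_norm// ler_wpM2l.
have phi4 z : `|phi z| <= 4.
  rewrite /phi normrM ger0_norm ?divr_ge0 ?(ltW Nd0)//.
  rewrite -[leRHS]mul1r ler_pM ?divr_ge0 ?(ltW Nd0)//.
    by rewrite ler_pdivrMr// mul1r ler_nat.
  rewrite (le_trans (ler_normB _ _))//; have := F2 z; lra.
have aphi0 : \sum_z a z * phi z = 0.
  rewrite /phi; under eq_bigr do rewrite mulrCA mulrBr.
  by rewrite -mulr_sumr sumrB -mulr_suml a1 mul1r -/mean subrr mulr0.
have aphi2 : \sum_z a z * phi z ^+ 2 <= V / n%:R.
  have -> : \sum_z a z * phi z ^+ 2 = (Nd / n%:R) ^+ 2 *
      (\sum_z a z * F z ^+ 2 - mean ^+ 2).
    transitivity ((Nd / n%:R) ^+ 2 * \sum_z (a z * F z ^+ 2 - 2 * mean * (a z * F z)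
        + mean ^+ 2 * a z)).
      by rewrite mulr_sumr; apply: eq_bigr => z _; rewrite /phi; ring.
    by rewrite big_split sumrB -!mulr_sumr /= a1 -/mean; congr (_ * _); ring.
  have -> : V / n%:R = (Nd / n%:R) ^+ 2 * (fmax / Nd * flux_energy).
    by rewrite VE; field; rewrite !gt_eqF.
  rewrite ler_wpM2l ?exprn_ge0 ?divr_ge0 ?(ltW Nd0)//.
  apply: (@le_trans _ _ (\sum_z a z * F z ^+ 2)).
    by rewrite gerBl exprn_even_ge0.
  apply: (@le_trans _ _ (\sum_z fmax / Nd * F z ^+ 2)).
    by apply: ler_sum => z _; rewrite ler_wpM2r// exprn_even_ge0.
  rewrite -mulr_sumr ler_wpM2l ?(@sum_flux_sqr_le R B K d B0 tail)//.
  have z0 : G := x.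
  exact: le_trans (a0 z0) (amax z0).
have := iid_moment r n0 a0 a1 aphi0 aphi2 phi4.
by rewrite [n%:R * _]mulrC divfK// gt_eqF.
Qed.

(** The [q]-th moments of the flow, with [q = r.*2.+2], are summed over the
[N ^ d] cells and their [2 d] faces; the powers of [N ^ d] in the lower bound on
[a] cancel those of the rescaling in [grid_flux_moment]. *)
Lemma grid_empirical (r n : nat) (a : G -> R) (fmin fmax V : R) :
  (0 < n)%N -> (N ^ d <= n)%N -> 0 < fmin -> 
  (forall z, fmin / (N ^ d)%:R <= a z <= fmax / (N ^ d)%:R) -> \sum_z a z = 1 ->
  V = (N ^ d)%:R * fmax * flux_energy / n%:R ->
  exists Psi : {ffun 'I_n -> G} -> R,
    (forall y, exists pi : G -> G -> R, is_coupling pi a (empirical_weight y) /\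
      transport_cost pi (fun x y => (1 + grid_dist x y) ^+ r.*2.+2) <= Psi y) /\
    iid_mean a Psi <=
      moment_constant d r fmin * (1 + V) ^+ r.+1.
Proof.
move=> n0 Nn fmin0 abnd a1 VE.
rewrite /moment_constant.
have nR0 : 0 < n%:R :> R by rewrite ltr0n.
have Nd0 : 0 < (N ^ d)%:R :> R by rewrite ltr0n !expn_gt0 B0.
have fN0 : 0 < fmin / (N ^ d)%:R by rewrite divr_gt0.
have amin z : fmin / (N ^ d)%:R <= a z by have /andP[] := abnd z.
have amax z : a z <= fmax / (N ^ d)%:R by have /andP[] := abnd z.
have apos z : 0 < a z by exact: lt_le_trans (amin z).
have a0 z : 0 <= a z by exact: ltW.
set c0 := expR (3 ^+ r.*2.+1 * r.*2.+2%:R) + 1.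
have c00 : 0 <= c0 by rewrite addr_ge0 ?expR_ge0.
pose g (y : {ffun 'I_n -> G}) (k : 'I_d * bool) (x : G) :=
  grid_flux (fun z => a z - empirical_weight y z) k.1 x (x k.1 + k.2).
pose Q (y : {ffun 'I_n -> G}) :=
  \sum_x (\sum_(k : 'I_d * bool) `|g y k x|) ^+ r.*2.+2 / a x ^+ r.*2.+1.
exists (fun y => c0 * (1 + Q y)); split=> [y|].
  have [pi [piab pic]] := @grid_coupling R B K d B0 a (empirical_weight y) r.*2.+1
    apos (empirical_weight_ge0 R y) a1 (sum_empirical_weight1 R n0 y).
  by exists pi.
rewrite iid_meanZ iid_meanD iid_mean_cst// -mulrA ler_wpM2l//.
have V0 : 0 <= V.
  have fmax0 : 0 <= fmax.
    have [z _|noG] := pickP (@predT G).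
      have := le_trans (a0 z) (amax z); rewrite pmulr_lge0// invr_gt0//.
    by move: a1; rewrite (eq_bigl _ _ noG) big_pred0_eq => /esym/eqP; rewrite oner_eq0.
  by rewrite VE divr_ge0// mulr_ge0 ?flux_energy_ge0// mulr_ge0.
have V1 : 1 <= 1 + V by rewrite lerDl.
have VV : V ^+ r.+1 + V * 4 ^+ r.*2 <= (1 + 4 ^+ r.*2) * (1 + V) ^+ r.+1.
  rewrite mulrDl mul1r lerD//.
    by rewrite lerXn2r ?nnegrE ?addr_ge0// lerDr.
  rewrite mulrC ler_wpM2l ?exprn_ge0// (@le_trans _ _ (1 + V)) ?lerDr//.
  by rewrite exprS ler_peMr ?addr_ge0// exprn_ege1.
set E := expR _ * _.
set M := r.*2.+1; set Nd : R := (N ^ d)%:R in VE Nd0 fN0 amin *.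
have E0 : 0 <= E by rewrite mulr_ge0 ?expR_ge0// addr_ge0 ?exprn_ge0.
rewrite mulrDl mul1r lerD ?exprn_ege1//.
pose Q' (y : {ffun 'I_n -> G}) : R := \sum_(x : G) \sum_(k : 'I_d * bool)
  ((d * 2)%:R ^+ M.+1 / fmin ^+ M / Nd) * (Nd * g y k x) ^+ M.+1.
apply: (@le_trans _ _ (iid_mean a Q')).
  apply: le_iid_mean => // y; apply: ler_sum => x _.
  rewrite -mulr_sumr ler_pdivrMr ?exprn_gt0//.
  apply: (le_trans (sum_expr_le M (fun k => normr_ge0 (g y k x)))).
  rewrite card_prod card_ord card_bool.
  under [X in _ <= _ * X * _]eq_bigr do rewrite exprMn.
  rewrite -mulr_sumr.
  have -> : \sum_i `|g y i x| ^+ M.+1 = \sum_i g y i x ^+ M.+1.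
    apply: eq_bigr => k _; rewrite -normrX ger0_norm//.
    by rewrite /M -doubleS -mul2n exprM exprn_ge0// exprn_even_ge0.
  set S := \sum_i _.
  have S0 : 0 <= S.
    apply: sumr_ge0 => k _.
    by rewrite /M -doubleS -mul2n exprM exprn_ge0// exprn_even_ge0.
  have -> : (d * 2)%:R ^+ M.+1 / fmin ^+ M / Nd * (Nd ^+ M.+1 * S) * a x ^+ M =
      (d * 2)%:R ^+ M.+1 * S * (a x / (fmin / Nd)) ^+ M.
    rewrite invf_div mulrCA exprMn expr_div_n [Nd ^+ M.+1]exprS; field.
    by rewrite expf_neq0 ?gt_eqF.
  rewrite ler_peMr ?(mulr_ge0 (exprn_ge0 _ (ler0n _ _)) S0)//.
  by rewrite exprn_ege1// ler_pdivlMr// mul1r amin.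
rewrite /Q' iid_mean_sum.
apply: (@le_trans _ _ (\sum_(x : G) \sum_(k : 'I_d * bool)
    ((d * 2)%:R ^+ M.+1 / fmin ^+ M / Nd) * (E * (1 + V) ^+ r.+1))).
  apply: ler_sum => x _; rewrite iid_mean_sum; apply: ler_sum => k _.
  rewrite iid_meanZ ler_wpM2l//.
    apply: divr_ge0 (ltW Nd0).
    by apply: divr_ge0; apply: exprn_ge0 => //; apply: ltW.
  apply: (le_trans (grid_flux_moment _ _ _ _ n0 Nn a0 a1 amax VE)).
  by rewrite /E -mulrA ler_wpM2l ?expR_ge0.
rewrite !sumr_const card_prod card_ord card_bool card_ffun !card_ord.
rewrite le_eqVlt; apply/orP; left; apply/eqP.
rewrite -[LHS]mulr_natl -[X in _ * X = _]mulr_natl -/Nd [_ ^+ M.+2]exprS.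
by field; rewrite expf_neq0 ?gt_eqF.
Qed.

End grid_empirical.

(** * Integrals, finite partitions and boxes *)

Section integrals.
Context {disp : measure_display} {T : measurableType disp} {R : realType}.
Variable mu : {measure set T -> \bar R}.
Local Open Scope ereal_scope.

(** The integral of a nonnegative function is a supremum over the simple
functions below it, so it is monotone even where measurability is unknown, as
for the Wasserstein distance to a random measure and for the cost of a
coupling. *)
Lemma ge0_le_integral_nonmeasurable (D : set T) (f g : T -> \bar R) :
  (forall x, 0 <= f x) -> (forall x, f x <= g x) ->
  \int[mu]_(x in D) f x <= \int[mu]_(x in D) g x.
Proof.
move=> f0 fg.
have g0 x : 0 <= g x by exact: le_trans (fg x).
have fD0 x : 0 <= (f \_ D) x by rewrite /patch; case: ifP.
have gD0 x : 0 <= (g \_ D) x by rewrite /patch; case: ifP.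
have fgD x : (f \_ D) x <= (g \_ D) x by rewrite /patch; case: ifP.
have negE (h : T -> \bar R) : (forall x, 0 <= h x) -> h^\- = cst 0.
  by move=> h0; apply/funext => x; rewrite funenegE max_r// oppe_le0.
have posE (h : T -> \bar R) : (forall x, 0 <= h x) -> h^\+ = h.
  by move=> h0; apply/funext => x; rewrite funeposE max_l.
rewrite /integral !negE// !posE//; apply: leeB => //.
apply: ereal_sup_le => _ [h hf <-]; exists h => // x.
exact: le_trans (hf x) (fgD x).
Qed.

Lemma integral_finite_valued (J : finType) (kappa : T -> J) (H : J -> R) :
  (forall j, measurable (kappa @^-1` [set j])) -> (forall j, (0 <= H j)%R) ->
  \int[mu]_x (H (kappa x))%:E = \sum_j (H j)%:E * mu (kappa @^-1` [set j]).
Proof.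
move=> mk H0.
transitivity (\int[mu]_x (\sum_j (H j)%:E * (\1_(kappa @^-1` [set j]) x)%:E)).
  apply: eq_integral => x _; rewrite (bigD1 (kappa x))//= indicE mem_set// mule1.
  rewrite big1 ?adde0// => j jk; rewrite indicE memNset ?mule0//=.
  by move=> /esym/eqP; rewrite (negPf jk).
pose F (j : J) : T -> \bar R := EFin \o \1_(kappa @^-1` [set j]).
have mI j : measurable_fun setT (F j).
  by apply/measurable_EFinP; apply: measurable_indic.
rewrite ge0_integral_sum//; last 2 first.
- by move=> j; exact: measurable_funeM (mI j).
- by move=> j x _; rewrite mule_ge0// lee_fin.
apply: eq_bigr => j _.
rewrite (ge0_integralZl mu measurableT (mI j)) ?lee_fin// /F.
  by rewrite integral_indic// setIT.
by move=> x _; rewrite lee_fin.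
Qed.

End integrals.

Lemma finite_sum_measure (disp : measure_display) (T : measurableType disp)
    (R : realType) (I : finType) (m : I -> {measure set T -> \bar R}) :
  exists M : {measure set T -> \bar R}, forall A, M A = (\sum_i m i A)%E.
Proof.
pose m' (k : nat) : {measure set T -> \bar R} :=
  if insub k is Some j then m (enum_val (j : 'I_#|I|)) else mzero.
exists (msum m' #|I|) => A; rewrite /msum.
rewrite [RHS](reindex (@enum_val I I)) /=; last first.
  by apply: onW_bij; exists enum_rank => x; rewrite ?enum_valK ?enum_rankK.
by apply: eq_big => [j|j _]; rewrite ?inE// /m' valK.
Qed.

Section box.
Context {R : realType}.

Lemma measurable_box (d : nat) (I : 'I_d -> set R) : (forall i, measurable (I i)) ->
  measurable [set a : d.-tuple R | forall i, I i (tnth a i)].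
Proof.
move=> mI; rewrite (_ : [set a | _] =
    \big[setI/setT]_(i < d) ((@tnth d R)^~ i @^-1` I i)); last first.
  apply/seteqP; split => a /=.
    by move=> aI; rewrite -bigcap_seq => i _ /=.
  by rewrite -bigcap_seq => aI i; have := aI i; rewrite /=; apply; rewrite mem_index_enum.
apply: bigsetI_measurable => i _; rewrite -[X in measurable X]setTI.
exact: measurable_tnth.
Qed.

Lemma lebesgue_tuple_box (d : nat) (I : 'I_d -> set R) : (forall i, measurable (I i)) ->
  lebesgue_tuple [set a : d.-tuple R | forall i, I i (tnth a i)] =
  (\prod_i lebesgue_measure (I i))%E.
Proof.
elim: d I => [|d IH] I mI.
  by rewrite big_ord0 /= diracE mem_set//; case.
rewrite big_ord_recl -(IH (fun i => I (lift ord0 i)))//=.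
rewrite /pushforward (_ : _ @^-1` _ =
    I ord0 `*` [set a : d.-tuple R | forall i, I (lift ord0 i) (tnth a i)]).
  rewrite product_measure1E; [by [] | exact: mI |].
  exact: (measurable_box (fun i => mI (lift ord0 i))).
apply/seteqP; split => [[x a]/= H|[x a]/= [H1 H2]].
  by split=> [|i]; [have := H ord0|have := H (lift ord0 i)];
    rewrite /tuple_cons/= ?tnth0 ?tnthS.
move=> i; case: (unliftP ord0 i) => [j ->|->]; rewrite /tuple_cons/= ?tnth0 ?tnthS//.
Qed.

End box.

(** * The cells of the torus *)

Section fractional_cell.
Context {R : realType}.

Definition frac (t : R) : R := t - (Num.floor t)%:~R.

Lemma frac_itv (t : R) : 0 <= frac t < 1.
Proof. by have := floor_itv t; rewrite /frac intrD => /andP[? ?]; apply/andP; split; lra. Qed.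

Lemma frac_id (t : R) : 0 <= t < 1 -> frac t = t.
Proof.
by move=> t01; rewrite /frac (@floor_def _ _ 0) ?mulr0z ?subr0// add0r.
Qed.

Lemma frac_congr (s t : R) : s - t \is a Num.int -> frac s = frac t.
Proof.
move=> st; rewrite /frac (_ : Num.floor s = Num.floor t + Num.floor (s - t)).
  by rewrite intrD (floorK st); ring.
by rewrite -floorDrz// addrC subrK.
Qed.

Variable N : nat.
Hypothesis N0 : (0 < N)%N.

Definition cell_index (t : R) : nat := Num.truncn (N%:R * frac t).

Let NR0 : 0 < N%:R :> R. Proof. by rewrite ltr0n. Qed.

Lemma cell_index_itv (t : R) :
  (cell_index t)%:R / N%:R <= frac t < (cell_index t).+1%:R / N%:R.
Proof.
have /andP[f0 _] := frac_itv t.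
rewrite ler_pdivrMr// ltr_pdivlMr// mulrC.
by apply: truncn_itv; rewrite mulr_ge0.
Qed.

Lemma cell_index_eq (t : R) (k : nat) :
  (cell_index t == k) = (k%:R / N%:R <= frac t < k.+1%:R / N%:R).
Proof.
have /andP[f0 _] := frac_itv t.
rewrite ler_pdivrMr// ltr_pdivlMr// mulrC.
by apply: truncn_eq; rewrite mulr_ge0.
Qed.

Lemma cell_index_lt (t : R) : (cell_index t < N)%N.
Proof.
have /andP[f0 f1] := frac_itv t.
by rewrite truncn_lt_nat ?mulr_ge0// gtr_pMr.
Qed.

(** A cell of the circle is a union of intervals over the integer parts. *)
Lemma measurable_cell_index (k : nat) : (k < N)%N ->
  measurable [set t | cell_index t = k].
Proof.
move=> kN.
have k1 : k.+1%:R / N%:R <= 1 :> R by rewrite ler_pdivrMr// mul1r ler_nat.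
have k0 : 0 <= k%:R / N%:R :> R by rewrite divr_ge0.
rewrite (_ : [set t | _] = \bigcup_(z : int)
    `[z%:~R + k%:R / N%:R, z%:~R + k.+1%:R / N%:R[%classic); last first.
  apply/seteqP; split => t /=.
    move/eqP; rewrite cell_index_eq /frac => /andP[? ?].
    by exists (Num.floor t) => //=; rewrite in_itv/=; apply/andP; split; lra.
  move=> [z _ /=]; rewrite in_itv/= => /andP[tz tz'].
  apply/eqP; rewrite cell_index_eq /frac (@floor_def _ _ z).
    by apply/andP; split; lra.
  by rewrite intrD; apply/andP; split; lra.
by apply: countable_bigcupT_measurable => // z; exact: measurable_itv.
Qed.

(** On the fundamental domain the cells are intervals. *)
Lemma cell_index_unit (t : R) (k : nat) : (k < N)%N ->
  (cell_index t = k /\ 0 <= t < 1) <-> k%:R / N%:R <= t < k.+1%:R / N%:R.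
Proof.
move=> kN.
have k1 : k.+1%:R / N%:R <= 1 :> R by rewrite ler_pdivrMr// mul1r ler_nat.
have k0 : 0 <= k%:R / N%:R :> R by rewrite divr_ge0.
split=> [[/eqP + t01]|tk]; first by rewrite cell_index_eq frac_id.
have t01 : 0 <= t < 1 by move: tk => /andP[? ?]; apply/andP; split; lra.
by split=> //; apply/eqP; rewrite cell_index_eq frac_id.
Qed.

End fractional_cell.

Section torus_cell.
Context {R : realType} {d N : nat} (N0 : (0 < N)%N).
Local Notation T := (torus R d).
Local Notation G := {ffun 'I_d -> 'I_N}.

Let NR0 : 0 < N%:R :> R. Proof. by rewrite ltr0n. Qed.

Definition torus_cell (z : T) : G :=
  [ffun i => Ordinal (cell_index_lt N0 (tnth (repr z) i))].

Lemma torus_cell_pi (a : d.-tuple R) (x : G) :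
  torus_cell (\pi_(torus R d) a)%qT = x <-> forall i, cell_index N (tnth a i) = x i.
Proof.
have E i : cell_index N (tnth (repr (\pi_(torus R d) a)%qT) i) = cell_index N (tnth a i).
  rewrite /cell_index; congr (Num.truncn (_ * _)); apply: frac_congr.
  have : (repr (\pi_(torus R d) a)%qT = a %[mod torus R d])%qT by rewrite reprK.
  by move=> /eqmodP/forallP.
split=> [<- i|H]; first by rewrite ffunE /= E.
by apply/ffunP => i; apply: val_inj; rewrite ffunE /= E H.
Qed.

Lemma measurable_torus_cell (x : G) : measurable (torus_cell @^-1` [set x]).
Proof.
rewrite /measurable/= /torus_measurable/= (_ : _ @^-1` _ =
    [set a | forall i, [set t | cell_index N t = x i] (tnth a i)]).
  apply: (@measurable_box _ _ (fun i => [set t | cell_index N t = x i])) => i.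
  exact: measurable_cell_index.
by apply/seteqP; split => a /= /torus_cell_pi.
Qed.

Lemma torus_lebesgue_cell (x : G) :
  torus_lebesgue (torus_cell @^-1` [set x]) = ((N ^ d)%:R^-1)%:E.
Proof.
pose I (i : 'I_d) : set R := `[(x i)%:R / N%:R, (x i).+1%:R / N%:R[%classic.
rewrite /torus_lebesgue (_ : _ `&` _ = [set a | forall i, I i (tnth a i)]); last first.
  apply/seteqP; split => a /=.
    move=> [/torus_cell_pi xa ua] i; rewrite /I/= in_itv/=.
    by apply/(cell_index_unit N0 (tnth a i) (ltn_ord (x i))); split; [exact: xa|exact: ua].
  move=> Ia; have H i : cell_index N (tnth a i) = x i /\ 0 <= tnth a i < 1.
    apply/(cell_index_unit N0 (tnth a i) (ltn_ord (x i))).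
    by have := Ia i; rewrite /I/= in_itv/=.
  by split; [apply/torus_cell_pi => i|move=> i]; case: (H i).
rewrite lebesgue_tuple_box; last by move=> i; exact: measurable_itv.
transitivity (\prod_(i < d) (N%:R^-1 : R)%:E)%E.
  apply: eq_bigr => i _; rewrite /I lebesgue_measure_itv /= lte_fin.
  rewrite ltr_pM2r ?invr_gt0// ltr_nat ltnSn -EFinD; congr _%:E.
  by rewrite -mulrBl -natr1 addrAC subrr add0r mul1r.
by rewrite -(big_morph EFin (@EFinM R) erefl) prodr_const card_ord natrX exprVn.
Qed.

Lemma torus_dist_ge0 (z z' : T) : 0 <= torus_dist z z'.
Proof.
apply: lb_le_inf; last by move=> _ [a _ [b _ <-]]; exact: sqrtr_ge0.
by exists (euclidean_dist (repr z) (repr z')); exists (repr z); rewrite /= ?reprK//;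
  exists (repr z'); rewrite /= ?reprK.
Qed.

Lemma euclidean_dist_le (a b : d.-tuple R) :
  euclidean_dist a b <= \sum_i `|tnth a i - tnth b i|.
Proof.
rewrite /euclidean_dist -[leRHS]ger0_norm ?sumr_ge0// -sqrtr_sqr ler_sqrt ?exprn_even_ge0//.
rewrite expr2 mulr_suml ler_sum// => i _.
rewrite -[leLHS]real_normK ?num_real// expr2 ler_wpM2l// (bigD1 i)//= lerDl.
by rewrite sumr_ge0.
Qed.

(** Choose the representatives in the unit cube; each coordinate differs by at
most one cell more than the indices do. *)
Lemma torus_dist_le (z z' : T) : (0 < d)%N ->
  torus_dist z z' <=
  d%:R / N%:R * (1 + grid_dist (torus_cell z) (torus_cell z')).
Proof.
move=> d0.
pose rep (z : T) : d.-tuple R := [tuple frac (tnth (repr z) i) | i < d].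
have repK (w : T) : (\pi_(torus R d) (rep w))%qT = w.
  rewrite -[RHS]reprK; apply/eqmodP/forallP => i.
  by rewrite tnth_mktuple /frac addrAC subrr add0r rpredN rpred_int.
have : torus_dist z z' <= euclidean_dist (rep z) (rep z').
  apply: ge_inf; first by exists 0 => _ [a _ [b _ <-]]; exact: sqrtr_ge0.
  by exists (rep z); [exact: repK|exists (rep z'); [exact: repK|]].
move/le_trans; apply; apply: (le_trans (euclidean_dist_le _ _)).
apply: (@le_trans _ _ (N%:R^-1 * \sum_(i < d)
    (`|(torus_cell z i)%:R - (torus_cell z' i)%:R| + 1))).
  rewrite mulr_sumr ler_sum// => i _; rewrite !tnth_mktuple !ffunE /=.
  have := cell_index_itv N0 (tnth (repr z) i).
  have := cell_index_itv N0 (tnth (repr z') i).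
  set f := frac _; set f' := frac _.
  rewrite -!natr1 !ler_pdivrMr// !ltr_pdivlMr// => /andP[f1 f2] /andP[f3 f4].
  rewrite mulrC ler_pdivlMr// -[N%:R in leLHS]gtr0_norm// -normrM mulrBl.
  set k := (_%:R : R) in f1 f2 *; set l := (_%:R : R) in f3 f4 *.
  by rewrite ler_norml; have := ler_norm (l - k); have := ler_norm (k - l);
    rewrite [`|k - l|]distrC; lra.
rewrite big_split /= sumr_const card_ord -/(grid_dist _ _).
rewrite [_ / _]mulrC -mulrA ler_wpM2l ?invr_ge0//.
rewrite mulrDr mulr1 addrC lerD2l ler_peMl ?grid_dist_ge0//.
by rewrite ler1n.
Qed.

End torus_cell.

(** * Lifting couplings to the torus *)

(** An alias on which a measure of total mass [1] receives its structure of
probability. *)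
Definition measure_copy (disp : measure_display) (T : measurableType disp)
  (R : realType) (M : {measure set T -> \bar R}) & M setT = 1%E :
  set T -> \bar R := M.

Section probability_of_measure.
Context (disp : measure_display) (T : measurableType disp) (R : realType).
Variables (M : {measure set T -> \bar R}) (M1 : M setT = 1%E).

HB.instance Definition _ := Measure.on (measure_copy M1).
HB.instance Definition _ := Measure_isProbability.Build _ _ _ (measure_copy M1) M1.

Definition probability_of_measure : probability T R := measure_copy M1.

End probability_of_measure.

Lemma measure_finite_partition (disp : measure_display) (T : measurableType disp)
    (R : realType) (mu : {measure set T -> \bar R}) (J : finType) (kappa : T -> J)
    (B : set T) : (forall j, measurable (kappa @^-1` [set j])) -> measurable B ->
  mu B = (\sum_j mu (B `&` kappa @^-1` [set j]))%E.
Proof.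
move=> mk mB.
have := @integral_finite_valued _ _ _ (mrestr mu mB) J kappa (fun=> 1%R) mk (fun=> ler01).
rewrite integral_cst// mul1e /= /mrestr setTI => ->.
by apply: eq_bigr => j _; rewrite mul1e setIC.
Qed.

(** Given the cells, the two points are taken independent: a sample point of
its cell and a point of law [mu] conditioned on its cell.  All values follow
from those on rectangles.  [esum] reorganizes sums over the sample according to
cells. *)
Lemma finite_coupling_lift (disp : measure_display) (T : measurableType disp)
    (R : realType) (mu : probability T R) (G : finType) (kappa : T -> G)
    (n : nat) (X : 'I_n -> T) (a : G -> R) (pi : G -> G -> R) :
  (0 < n)%N -> (forall x, measurable (kappa @^-1` [set x])) ->
  (forall x, mu (kappa @^-1` [set x]) = (a x)%:E) -> (forall x, 0 < a x) ->
  is_coupling pi a (empirical_weight [ffun j => kappa (X j)]) ->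
  exists Pi : probability (T * T)%type R,
    [/\ forall A, measurable A -> Pi (fst @^-1` A) = empirical_measure X A,
        forall B, measurable B -> Pi (snd @^-1` B) = mu B &
        forall x1 x2, Pi ((kappa @^-1` [set x1]) `*` (kappa @^-1` [set x2])) =
          (pi x2 x1)%:E].
Proof.
move=> n0 mk muk a0 [pi0 pia pib].
have nR0 : 0 < n%:R :> R by rewrite ltr0n.
set y := [ffun j => kappa (X j)] in pib.
pose e (g : G) : R := empirical_weight y g.
have e0 g : 0 <= e g by exact: empirical_weight_ge0.
have ey j : 0 < e (y j).
  rewrite /e /empirical_weight mulr_gt0 ?invr_gt0// (bigD1 j)//= eqxx.
  by rewrite ltr_pwDl// sumr_ge0.
have esum (h : G -> R) : (forall g, e g = 0 -> h g = 0) ->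
    \sum_j h (y j) / (n%:R * e (y j)) = \sum_g h g.
  move=> h0; transitivity (\sum_g e g * (h g / e g)).
    rewrite sum_empirical_weight mulr_sumr; apply: eq_bigr => j _.
    by rewrite invfM; ring.
  apply: eq_bigr => g _; have [eg|eg] := eqVneq (e g) 0.
    by rewrite eg mul0r h0.
  by rewrite mulrCA divff// mulr1.
have pi_e x g : e g = 0 -> pi x g = 0.
  move=> eg; have := pib g; rewrite -/(e g) eg => /eqP.
  by rewrite psumr_eq0// => /allP/(_ x); rewrite mem_index_enum => /(_ isT)/eqP.
(* [n%:R * e (y j)] is the number of sample points in the cell of [X j]. *)
pose c (k : 'I_n * G) : R := pi k.2 (y k.1) / (n%:R * e (y k.1)) / a k.2.
have c0 k : 0 <= c k.
  apply: divr_ge0 (ltW (a0 _)).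
  by apply: divr_ge0 => //; exact: mulr_ge0.
have mufin x : (mu (kappa @^-1` [set x]) < +oo)%E by rewrite muk ltry.
pose m (k : 'I_n * G) : {measure set (T * T)%type -> \bar R} :=
  mscale (NngNum (c0 k)) (\d_(X k.1) \x mfrestr (mk k.2) (mufin k.2))%E.
have [M ME] := finite_sum_measure m.
pose mB (B : set T) (x : G) : R := fine (mu (B `&` kappa @^-1` [set x])).
have mBE B x : measurable B -> mu (B `&` kappa @^-1` [set x]) = (mB B x)%:E.
  by move=> mBm; rewrite fineK// fin_num_measure//; exact: measurableI.
have mBT x : mB setT x = a x by rewrite /mB setTI muk.
have Mrect A B : measurable A -> measurable B -> M (A `*` B) =
    (\sum_(j < n) \sum_x c (j, x) * (\1_A (X j) * mB B x))%:E.
  move=> mA mBm; rewrite ME pair_bigA /= -sumEFin; apply: eq_bigr => -[j x] _ /=.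
  rewrite /mscale /= product_measure1E// [RHS]EFinM; congr (_ * _)%E.
  by rewrite [RHS]EFinM /mfrestr /mrestr -mBE// diracE indicE.
have M1 A : measurable A -> M (A `*` setT) = empirical_measure X A.
  move=> mA; rewrite Mrect//.
  transitivity ((n%:R^-1 * \sum_j \1_A (X j) : R)%:E); last first.
    by rewrite /empirical_measure EFinM -sumEFin.
  congr _%:E; rewrite [RHS]mulr_sumr; apply: eq_bigr => j _.
  transitivity (\sum_x pi x (y j) * (\1_A (X j) / (n%:R * e (y j)))).
    apply: eq_bigr => x _; rewrite mBT /c /=; field.
    by rewrite !gt_eqF.
  rewrite -mulr_suml pib -/(e _) invfM; field.
  by rewrite !gt_eqF.
have M2 B : measurable B -> M (setT `*` B) = mu B.
  move=> mBm; rewrite Mrect// (measure_finite_partition mu mk mBm).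
  transitivity ((\sum_x mB B x)%:E); last first.
    by rewrite -sumEFin; apply: eq_bigr => x _; exact/esym/mBE.
  congr _%:E; rewrite exchange_big; apply: eq_bigr => x _ /=.
  transitivity (mB B x / a x * \sum_j pi x (y j) / (n%:R * e (y j))).
    by rewrite mulr_sumr; apply: eq_bigr => j _; rewrite indicT mul1r /c/=; ring.
  by rewrite esum ?pia ?divfK ?gt_eqF// => g; exact: pi_e.
have MT : M setT = 1%E by rewrite -setXTT M2// probability_setT.
exists (probability_of_measure MT); split.
- move=> A mA; rewrite -M1//; congr (M _).
  by apply/seteqP; split => -[x x'] //= [].
- move=> B mBm; rewrite -M2//; congr (M _).
  by apply/seteqP; split => -[x x'] //= [].
- move=> x1 x2; rewrite [LHS](Mrect _ _ (mk x1) (mk x2)); congr _%:E.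
  have mBk x : mB (kappa @^-1` [set x2]) x = (x == x2)%:R * a x2.
    rewrite /mB; have [->|xx2] := eqVneq x x2; first by rewrite setIid muk mul1r.
    rewrite (_ : _ `&` _ = set0) ?measure0 ?mul0r//.
    by apply/seteqP; split => // z [/= -> xE]; rewrite xE eqxx in xx2.
  transitivity (\sum_j (y j == x1)%:R * pi x2 (y j) / (n%:R * e (y j))).
    apply: eq_bigr => j _; rewrite (bigD1 x2)//= big1 ?addr0 => [|x xx2].
      have -> : \1_(kappa @^-1` [set x1]) (X j) = (y j == x1)%:R :> R.
        by rewrite indicE /y ffunE; congr ((nat_of_bool _)%:R); apply/idP/eqP; rewrite inE.
      rewrite mBk eqxx mul1r /c /=; field.
      by rewrite !gt_eqF.
    by rewrite mBk (negPf xx2) mul0r !mulr0.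
  rewrite (esum (fun g => (g == x1)%:R * pi x2 g)); last first.
    by move=> g /pi_e ->; rewrite mulr0.
  rewrite (bigD1 x1)//= eqxx mul1r big1 ?addr0// => g /negPf ->.
  by rewrite mul0r.
Qed.

Lemma powR_le_expr (R : realType) (u p : R) (q : nat) :
  0 <= u -> 0 <= p -> p <= q%:R -> u `^ p <= 1 + u ^+ q.
Proof.
move=> u0 p0 pq; have [u1|u1] := leP u 1.
  rewrite -[leLHS]addr0 lerD ?exprn_ge0//.
  by rewrite (le_trans (ge0_ler_powR p0 _ _ u1)) ?nnegrE// powR1.
rewrite -[leLHS]add0r lerD// -powR_mulrn//.
exact: ler_powR (ltW u1) _ _ pq.
Qed.

(** The passage from the exponent [p] to [q] and the extraction of the root are
both done at the scale [s = d / N * tau]: [u `^ p <= 1 + u ^+ q] is applied to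
[u] the bound of [torus_dist_le] divided by [s], and [(1 + x) `^ p^-1 <= 1 + x].
The bound is linear in the cost [psi], which is what allows taking expectations.
*)
Lemma wasserstein_le (R : realType) (d N : nat) (N0 : (0 < N)%N)
    (mu : probability (torus R d) R) (n : nat) (X : 'I_n -> torus R d)
    (a : {ffun 'I_d -> 'I_N} -> R) (pi : {ffun 'I_d -> 'I_N} -> {ffun 'I_d -> 'I_N} -> R)
    (p tau psi : R) (q : nat) :
  (0 < n)%N -> (0 < d)%N -> 1 <= p -> p <= q%:R -> 0 < tau ->
  (forall x, mu (torus_cell N0 @^-1` [set x]) = (a x)%:E) -> (forall x, 0 < a x) ->
  is_coupling pi a (empirical_weight [ffun j => torus_cell N0 (X j)]) ->
  transport_cost pi (fun x y => (1 + grid_dist x y) ^+ q) <= psi ->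
  (wasserstein p (empirical_measure X) mu <=
   (d%:R / N%:R * tau * (1 + psi / tau ^+ q))%:E)%E.
Proof.
move=> n0 d0 p1 pq tau0 mua a0 piab pipsi.
have p0 : 0 < p by rewrite (lt_le_trans _ p1).
have [Pi [Pi1 Pi2 Pik]] := finite_coupling_lift n0 (measurable_torus_cell N0) mua a0 piab.
have [pi0 pia pib] := piab.
set s := d%:R / N%:R * tau.
have s0 : 0 < s by rewrite /s !mulr_gt0 ?invr_gt0 ?ltr0n.
pose kap2 (z : torus R d * torus R d) := (torus_cell N0 z.1, torus_cell N0 z.2).
have kap2E x1 x2 : kap2 @^-1` [set (x1, x2)] =
    (torus_cell N0 @^-1` [set x1]) `*` (torus_cell N0 @^-1` [set x2]).
  by apply/seteqP; split => -[z1 z2] /=; [case=> -> ->|case=> /= <- <-].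
have Pik2 k : Pi (kap2 @^-1` [set k]) = (pi k.2 k.1)%:E.
  by case: k => x1 x2; rewrite kap2E Pik.
pose H (k : {ffun 'I_d -> 'I_N} * {ffun 'I_d -> 'I_N}) : R :=
  s `^ p * (1 + (1 + grid_dist k.1 k.2) ^+ q / tau ^+ q).
have H0 k : 0 <= H k.
  by rewrite mulr_ge0 ?powR_ge0// addr_ge0// divr_ge0 ?exprn_ge0 ?addr_ge0 ?grid_dist_ge0 ?ltW.
have psi0 : 0 <= psi.
  apply: le_trans pipsi; apply: transport_cost_ge0 => // x y.
  by rewrite exprn_ge0// addr_ge0// grid_dist_ge0.
have tq0 : 0 < tau ^+ q by rewrite exprn_gt0.
have u1 : 1 <= 1 + psi / tau ^+ q by rewrite lerDl divr_ge0// ltW.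
have intle : (\int[Pi]_z ((torus_dist z.1 z.2) `^ p)%:E <=
    (s `^ p * (1 + psi / tau ^+ q))%:E)%E.
  apply: (@le_trans _ _ (\int[Pi]_z (H (kap2 z))%:E)%E).
    apply: ge0_le_integral_nonmeasurable => [z|z]; first by rewrite lee_fin powR_ge0.
    rewrite lee_fin /H /=; set g := grid_dist _ _.
    have g0 : 0 <= 1 + g by rewrite addr_ge0 ?grid_dist_ge0.
    have zg : torus_dist z.1 z.2 <= s * ((1 + g) / tau).
      apply: (le_trans (torus_dist_le N0 z.1 z.2 d0)); rewrite -/g /s.
      by rewrite le_eqVlt; apply/orP; left; apply/eqP; field; rewrite !gt_eqF ?ltr0n.
    have gt0 : 0 <= (1 + g) / tau by rewrite divr_ge0 ?(ltW tau0).
    rewrite (le_trans (ge0_ler_powR (ltW p0) _ _ zg)) ?nnegrE ?torus_dist_ge0//.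
      by rewrite mulr_ge0 ?(ltW s0).
    rewrite powRM ?(ltW s0)// ler_wpM2l ?powR_ge0// -expr_div_n.
    exact: powR_le_expr (ltW p0) pq.
  rewrite integral_finite_valued//; last first.
    move=> [x1 x2]; rewrite kap2E.
    by apply: measurableX; exact: measurable_torus_cell.
  rewrite (eq_bigr (fun k => (H k * pi k.2 k.1)%:E)); last first.
    by move=> k _; rewrite [RHS]EFinM; congr (_ * _)%E; exact: Pik2.
  rewrite sumEFin lee_fin -(pair_bigA _ (fun x1 x2 => H (x1, x2) * pi x2 x1)) /=.
  rewrite exchange_big /=.
  have pi1 : \sum_x \sum_y pi x y = 1.
    have := probability_setT Pi; rewrite -[setT]setXTT.
    rewrite (measure_finite_partition Pi (kappa := kap2) (B := setT `*` setT)) ?setXTT//.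
      rewrite (eq_bigr (fun k => (pi k.2 k.1)%:E)); last first.
        by move=> k _; rewrite setTI; exact: Pik2.
      rewrite sumEFin -(pair_bigA _ (fun x1 x2 => pi x2 x1)) /= exchange_big /=.
      by case.
    move=> [x1 x2]; rewrite kap2E.
    by apply: measurableX; exact: measurable_torus_cell.
  have -> : \sum_x2 \sum_x1 H (x1, x2) * pi x2 x1 = s `^ p * (\sum_x \sum_y pi x y +
      transport_cost pi (fun x y => (1 + grid_dist x y) ^+ q) / tau ^+ q).
    rewrite /transport_cost mulr_suml -big_split mulr_sumr /=; apply: eq_bigr => x _.
    rewrite mulr_suml -big_split mulr_sumr /=; apply: eq_bigr => x' _.
    rewrite /H /= (_ : grid_dist x' x = grid_dist x x' :> R); last first.
      by apply: eq_bigr => j _; rewrite distrC.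
    by ring.
  by rewrite pi1 ler_wpM2l ?powR_ge0// lerD2l ler_wpM2r// invr_ge0 ltW.
apply: ge_ereal_inf; eexists; first by exists Pi; [split|].
apply: (@le_trans _ _ ((s `^ p * (1 + psi / tau ^+ q))%:E `^ p^-1)%E).
  apply: gt0_ler_poweR; rewrite ?invr_ge0 ?(ltW p0)// in_itv/= ?leey ?andbT.
    by apply: integral_ge0 => z _; rewrite lee_fin powR_ge0.
  by rewrite lee_fin mulr_ge0 ?powR_ge0// (le_trans ler01 u1).
rewrite poweR_EFin lee_fin powRM ?powR_ge0 ?(le_trans ler01 u1)//.
rewrite -powRrM mulfV ?gt_eqF// powRr1 ?(ltW s0)// ler_wpM2l ?(ltW s0)//.
rewrite -[leRHS]powRr1 ?(le_trans ler01 u1)//; apply: ler_powR => //.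
by rewrite invf_le1.
Qed.

(** * The expected distance *)

(** The density is clamped to [[fmin, fmax]], which changes it on a null set
only, so that it can be compared everywhere with constants. *)
Lemma cell_mass (R : realType) (d N : nat) (N0 : (0 < N)%N) (fmin fmax : R)
    (mu : probability (torus R d) R) (f : torus R d -> R) :
  0 < fmin -> fmin <= fmax -> measurable_fun setT f ->
  {ae torus_lebesgue, forall x, fmin <= f x <= fmax} ->
  (forall A : set (torus R d), measurable A ->
      mu A = (\int[torus_lebesgue]_(x in A) (f x)%:E)%E) ->
  exists a : {ffun 'I_d -> 'I_N} -> R,
    [/\ forall x, mu (torus_cell N0 @^-1` [set x]) = (a x)%:E,
        forall x, fmin / (N ^ d)%:R <= a x <= fmax / (N ^ d)%:R &
        \sum_x a x = 1].
Proof.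
move=> fmin0 fminmax mf fae fmu.
have mk := measurable_torus_cell N0 (d := d) (R := R).
pose a x : R := fine (mu (torus_cell N0 @^-1` [set x])).
have muE x : mu (torus_cell N0 @^-1` [set x]) = (a x)%:E.
  by rewrite fineK// fin_num_measure//; exact: mk.
exists a; split=> // [x|].
  pose g z : R := Num.max fmin (Num.min (f z) fmax).
  have mg : measurable_fun setT g.
    by apply: measurable_maxr => //; exact: measurable_minr.
  have g_ge z : fmin <= g z by rewrite le_max lexx.
  have g_le z : g z <= fmax by rewrite ge_max fminmax ge_min lexx orbT.
  pose A : set (torus R d) := torus_cell N0 @^-1` [set x]; have mA : measurable A := mk x.
  have mEA (h : torus R d -> R) : measurable_fun setT h -> measurable_fun A (EFin \o h).
    by move=> mh; apply/measurable_EFinP; exact: measurable_funTS.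
  have muA : (a x)%:E = (\int[torus_lebesgue]_(z in A) (g z)%:E)%E.
    rewrite -muE fmu//; apply: ae_eq_integral => //; [exact: mEA|exact: mEA|].
    apply: filterS fae => z /andP[f1 f2] _; congr _%:E.
    by rewrite /g min_l// max_r.
  have lebA : torus_lebesgue A = ((N ^ d)%:R^-1)%:E by exact: torus_lebesgue_cell.
  have cstA (c : R) : (\int[torus_lebesgue]_(z in A) c%:E)%E = (c / (N ^ d)%:R)%:E.
    transitivity (c%:E * torus_lebesgue A)%E; first exact: integral_cst.
    by rewrite lebA -EFinM.
  apply/andP; split; rewrite -lee_fin -cstA muA.
    apply: ge0_le_integral => //.
    - by move=> z _; rewrite lee_fin ltW.
    - exact: mEA.
    - by move=> z _; rewrite lee_fin.
  apply: ge0_le_integral => //.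
  - by move=> z _; rewrite lee_fin (le_trans (ltW fmin0)).
  - exact: mEA.
  - by move=> z _; rewrite lee_fin.
apply: EFin_inj; rewrite -sumEFin -(probability_setT mu).
rewrite (measure_finite_partition mu mk measurableT).
by apply: eq_bigr => x _; rewrite setTI -muE.
Qed.

Lemma wasserstein_ge0 (R : realType) (d : nat) (p : R)
    (mu nu : {measure set (torus R d) -> \bar R}) :
  (0 <= wasserstein p mu nu)%E.
Proof. by apply: le_ereal_inf_tmp => _ [Pi _ <-]; exact: poweR_ge0. Qed.

(** Independence is used for the full index set and the preimages of the cells
of [y]. *)
Lemma iid_cell_law (disp disp' : measure_display) (W : measurableType disp)
    (T : measurableType disp') (R : realType) (mu : probability T R)
    (P : probability W R) (n : nat) (X : 'I_n -> {RV P >-> T})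
    (G : finType) (kappa : T -> G) (a : G -> R) :
  (forall x, measurable (kappa @^-1` [set x])) ->
  (forall x, mu (kappa @^-1` [set x]) = (a x)%:E) -> iid_sample mu X ->
  let Y w := [ffun j => kappa (X j w)] in forall y,
  measurable (Y @^-1` [set y]) /\ P (Y @^-1` [set y]) = (\prod_j a (y j))%:E.
Proof.
move=> mk mua [indep law] Y y.
have mX i : measurable (X i @^-1` (kappa @^-1` [set y i])).
  by apply: measurable_funPTI.
have YE : Y @^-1` [set y] =
    \bigcap_(i in [set` [set: 'I_n]%SET]) (X i @^-1` (kappa @^-1` [set y i])).
  apply/seteqP; split => w /= => [<- i _|H]; first by rewrite /= ffunE.
  by apply/ffunP => i; rewrite ffunE; apply: (H i); rewrite /= finset.in_setT.
rewrite YE; split; first by apply: fin_bigcap_measurable => // i _; exact: mX.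
rewrite (indep [set: 'I_n]%SET (fun i => kappa @^-1` [set y i]))//.
rewrite (big_morph EFin (@EFinM R) erefl).
apply: eq_big => [i|i _]; first by rewrite finset.in_setT.
by rewrite -mua -(law i).
Qed.

(** With [tau = sqrt (1 + V)], the power [tau ^ q] is the bound [(1 + V) ^ r.+1]
of [grid_empirical], so the expectation of the bound of [wasserstein_le] is a
constant times [tau / N]. *)
Lemma expected_wasserstein_le (R : realType) (d B K n r : nat) (fmin fmax : R)
    (mu : probability (torus R d) R) (f : torus R d -> R) (p : R) :
  (0 < d)%N -> (0 < B)%N -> (0 < n)%N -> ((B ^ K) ^ d <= n)%N ->
  (forall m, (m < K)%N ->
    \sum_(m <= l < K) level_weight B d l <= 2 * level_weight B d m :> R) ->
  0 < fmin -> fmin <= fmax -> measurable_fun setT f ->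
  {ae torus_lebesgue, forall x, fmin <= f x <= fmax} ->
  (forall A : set (torus R d), measurable A ->
      mu A = (\int[torus_lebesgue]_(x in A) (f x)%:E)%E) ->
  1 <= p -> p <= r.*2.+2%:R ->
  forall (disp : measure_display) (W : measurableType disp)
      (P : probability W R) (X : 'I_n -> {RV P >-> torus R d}),
      iid_sample mu X ->
  (\int[P]_w wasserstein p (empirical_measure (fun j => X j w)) mu <=
  (d%:R / (B ^ K)%:R *
    Num.sqrt (1 + ((B ^ K) ^ d)%:R * fmax * flux_energy B K d / n%:R) *
    (1 + moment_constant d r fmin))%:E)%E.
Proof.
move=> d0 B0 n0 Nn tail fmin0 fminmax mf fae fmu p1 pr disp W P X iidX.
have N0 : (0 < B ^ K)%N by rewrite expn_gt0 B0.
have [a [mua abnd a1]] := cell_mass N0 fmin0 fminmax mf fae fmu.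
set V : R := _ / n%:R.
have [Psi [Psi1 Psi2]] := grid_empirical B0 tail r n0 Nn fmin0 abnd a1 (erefl V).
have apos z : 0 < a z.
  have /andP[+ _] := abnd z; apply: lt_le_trans.
  by rewrite divr_gt0// ltr0n expn_gt0 N0.
have a0 z : 0 <= a z by exact: ltW.
have V0 : 0 <= V.
  by rewrite /V divr_ge0// mulr_ge0 ?flux_energy_ge0// mulr_ge0// (le_trans (ltW fmin0)).
pose tau := Num.sqrt (1 + V).
have tau0 : 0 < tau by rewrite sqrtr_gt0 ltr_pwDl.
have tauE : tau ^+ r.*2.+2 = (1 + V) ^+ r.+1.
  by rewrite -doubleS -mul2n exprM sqr_sqrtr// addr_ge0.
have Psi0 y : 0 <= Psi y.
  have [pi [[pi0 _ _]]] := Psi1 y; apply: le_trans; apply: transport_cost_ge0 => // x z.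
  by rewrite exprn_ge0// addr_ge0// grid_dist_ge0.
rewrite -/tau; set s := _ * tau.
have s0 : 0 <= s by rewrite /s mulr_ge0 ?divr_ge0// ltW.
pose h (y : {ffun 'I_n -> {ffun 'I_d -> 'I_(B ^ K)}}) := s * (1 + Psi y / tau ^+ r.*2.+2).
have tq0 : 0 < tau ^+ r.*2.+2 by rewrite exprn_gt0.
pose Y w := [ffun j => torus_cell N0 (X j w)].
have law := iid_cell_law (measurable_torus_cell N0) mua iidX.
apply: (@le_trans _ _ (\int[P]_w (h (Y w))%:E)%E).
  apply: ge0_le_integral_nonmeasurable => w; first exact: wasserstein_ge0.
  have [pi [piab pic]] := Psi1 (Y w).
  exact: (wasserstein_le n0 d0 p1 pr tau0 mua apos piab pic).
rewrite integral_finite_valued; last 2 first.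
- by move=> y; case: (law y).
- by move=> y; rewrite mulr_ge0// addr_ge0// divr_ge0// ltW.
rewrite (eq_bigr (fun y => (h y * \prod_j a (y j))%:E)); last first.
  by move=> y _; rewrite [RHS]EFinM; congr (_ * _)%E; case: (law y).
rewrite sumEFin lee_fin.
have -> : \sum_y h y * \prod_j a (y j) = iid_mean a h.
  by apply: eq_bigr => y _; rewrite mulrC.
rewrite iid_meanZ iid_meanD iid_mean_cst// ler_wpM2l// lerD2l.
rewrite (_ : (fun y => _) = (fun y => (tau ^+ r.*2.+2)^-1 * Psi y)); last first.
  by apply/funext => y; rewrite mulrC.
by rewrite iid_meanZ mulrC ler_pdivrMr// tauE.
Qed.

(** * Choice of the scale *)

Lemma halving_tail (R : realFieldType) (w : nat -> R) (K m : nat) :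
  (forall l, 0 <= w l) -> (forall l, 2 * w l.+1 <= w l) -> (m < K)%N ->
  \sum_(m <= l < K) w l <= 2 * w m.
Proof.
move=> w0 wS mK.
suff H k : forall i, \sum_(i <= l < i + k) w l <= 2 * w i.
  by have := H (K - m)%N m; rewrite subnKC// ltnW.
elim: k => [|k IH] i; first by rewrite addn0 big_geq// mulr_ge0.
rewrite big_ltn ?addnS ?ltnS ?leq_addr// -addSn.
by have := IH i.+1; have := wS i; lra.
Qed.

Lemma level_weight_dyadic (R : realType) (d m : nat) : (2 <= d)%N ->
  2 * level_weight 2 d m.+1 <= level_weight 2 d m :> R.
Proof.
move=> d2; rewrite /level_weight expnS natrM exprMn invfM mulrA.
rewrite ler_piMl ?invr_ge0 ?exprn_ge0// -[X in X / _]expr1.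
rewrite ler_pdivrMr ?exprn_gt0// mul1r.
by apply: ler_weXn2l => //; [rewrite ler1n|lia].
Qed.

Lemma flux_energy_dyadic2 (R : realType) (K : nat) :
  flux_energy 2 K 2 = 16 * K%:R :> R.
Proof.
rewrite /flux_energy (eq_bigr (fun=> 4)) => [|m _].
  by rewrite sumr_const card_ord -[X in _ * X]mulr_natr mulrA -natrM.
rewrite /level_weight /= expr1 [(2 ^ m.+1)%N]expnS expnMn natrM [((2 ^ m) ^ 2)%:R]natrX exprVn.
by rewrite mulrCA mulVf ?mulr1// expf_neq0// pnatr_eq0 -lt0n expn_gt0.
Qed.

Lemma flux_energy_dyadic (R : realType) (K d : nat) : (3 <= d)%N ->
  flux_energy 2 K d <= 8 * 2 ^+ d :> R.
Proof.
move=> d3; rewrite /flux_energy.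
have -> : 8 * 2 ^+ d = 4 * (2 * 2 ^+ d) :> R by ring.
rewrite ler_wpM2l//.
case: K => [|K]; first by rewrite big_ord0 mulr_ge0 ?exprn_ge0.
pose w (m : nat) : R := 2 ^+ d * 2 ^- m.
have w0E : w 0%N = 2 ^+ d by rewrite /w expr0 invr1 mulr1.
have := @halving_tail R w K.+1 0; rewrite w0E big_mkord => H; apply: le_trans (H _ _ _) => //.
- apply: ler_sum => m _; rewrite /level_weight /w expnS expnMn natrM !natrX.
  rewrite mulrCA ler_wpM2l ?exprn_ge0//.
  rewrite exprVn -!exprM mulrC -[leRHS]mul1r ler_pdivrMr ?exprn_gt0//.
  rewrite mul1r ler_pdivlMl ?exprn_gt0// -exprD.
  apply: ler_weXn2l; first by rewrite ler1n.
  by nia.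
- by move=> l; rewrite mulr_ge0 ?invr_ge0 ?exprn_ge0.
- by move=> l; rewrite /w exprS invfM mulrCA mulVKf// lexx.
Qed.

Lemma flux_energy_single_level (R : realType) (n : nat) : flux_energy n 1 1 = 4 * n%:R :> R.
Proof.
by rewrite /flux_energy big_ord1 /level_weight /= expr0 invr1 expr1n mul1r !expn1.
Qed.

Lemma moment_constant_ge0 (R : realType) (d r : nat) (fmin : R) :
  0 <= fmin -> 0 <= moment_constant d r fmin.
Proof.
move=> fmin0; rewrite /moment_constant.
apply: mulr_ge0; apply: addr_ge0; rewrite ?expR_ge0//.
apply: mulr_ge0; first by apply: divr_ge0; apply: exprn_ge0.
by apply: mulr_ge0; rewrite ?expR_ge0// addr_ge0// exprn_ge0.
Qed.

(** The largest dyadic grid with at most [n] cells. *)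
Lemma dyadic_scale (R : realType) (d n : nat) : (0 < d)%N -> (0 < n)%N ->
  exists K, [/\ ((2 ^ K) ^ d <= n)%N,
    (2 ^ K)%:R^-1 <= 2 * n%:R `^ (- d%:R^-1) :> R & K%:R * ln 2 <= ln n%:R :> R].
Proof.
move=> d0 n0; exists (trunc_log (2 ^ d) n); set K := trunc_log _ n.
have d1 : (1 < 2 ^ d)%N by rewrite -[1%N](expn0 2) ltn_exp2l.
have /andP[Kn nK] := trunc_log_bounds d1 n0; rewrite -/K in Kn nK.
have KE : ((2 ^ K) ^ d = (2 ^ d) ^ K)%N by rewrite -!expnM mulnC.
have nR0 : 0 < n%:R :> R by rewrite ltr0n.
have dR0 : 0 < d%:R :> R by rewrite ltr0n.
have K0 : 0 < (2 ^ K)%:R :> R by rewrite ltr0n expn_gt0.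
split; first by rewrite KE.
- have : n%:R `^ d%:R^-1 <= 2 * (2 ^ K)%:R :> R.
    have -> : 2 * (2 ^ K)%:R = ((2 * (2 ^ K)%:R) `^ d%:R) `^ d%:R^-1 :> R.
      by rewrite -powRrM divff ?gt_eqF// powRr1// mulr_ge0.
    apply: ge0_ler_powR; rewrite ?nnegrE ?invr_ge0 ?powR_ge0//.
    rewrite powR_mulrn ?mulr_ge0// -natrM -natrX ler_nat ltnW//.
    by rewrite -expnS -expnM mulnC expnM.
  by rewrite powRN ler_pdivlMr ?powR_gt0// ler_pdivrMl// mulrC.
- rewrite mulr_natl -lnXn// ler_ln ?posrE ?exprn_gt0//.
  rewrite -natrX ler_nat (leq_trans _ Kn)// -KE.
  by rewrite -[X in (X <= _)%N]expn1 leq_pexp2l// expn_gt0.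
Qed.

Theorem mainTheorem1 (R : realType) (d : nat) (d_ge1 : (1 <= d)%N)
    (fmin fmax : R) (fmin_gt0 : 0 < fmin) (fmin_le_fmax : fmin <= fmax)
    (mu : probability (torus R d) R)
    (f : torus R d -> R) (f_meas : measurable_fun setT f)
    (f_bounds : {ae torus_lebesgue, forall x, fmin <= f x <= fmax})
    (f_density : forall A : set (torus R d), measurable A ->
      mu A = (\int[torus_lebesgue]_(x in A) (f x)%:E)%E)
    (p : R) (p_ge1 : 1 <= p) :
  exists C : R, forall n : nat, (1 <= n)%N -> (d = 2%N -> (2 <= n)%N) ->
    forall (disp : measure_display) (W : measurableType disp)
      (P : probability W R) (X : 'I_n -> {RV P >-> torus R d}),
      iid_sample mu X ->
      (\int[P]_w wasserstein p (empirical_measure (fun j => X j w)) mu <=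
        (C * convergence_rate R d n)%:E)%E.
Proof.
pose r := Num.truncn p.
have pr : p <= r.*2.+2%:R.
  by rewrite ltW// (lt_le_trans (truncnS_gt p))// ler_nat ltnS -addnn leqW ?leq_addr.
pose C0 : R := 1 + moment_constant d r fmin.
have C00 : 0 <= C0 by rewrite addr_ge0 ?moment_constant_ge0// ltW.
have fmax0 : 0 < fmax by exact: lt_le_trans fmin_le_fmax.
have E B K n (B0 : (0 < B)%N) (n0 : (0 < n)%N) (Nn : ((B ^ K) ^ d <= n)%N) tail :=
  @expected_wasserstein_le R d B K n r fmin fmax mu f p d_ge1 B0 n0 Nn tail
    fmin_gt0 fmin_le_fmax f_meas f_bounds f_density p_ge1 pr.
have Edyadic : (2 <= d)%N -> forall n K : nat, (0 < n)%N -> ((2 ^ K) ^ d <= n)%N ->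
    (2 ^ K)%:R^-1 <= 2 * n%:R `^ (- d%:R^-1) :> R ->
    forall (disp : measure_display) (W : measurableType disp)
      (P : probability W R) (X : 'I_n -> {RV P >-> torus R d}), iid_sample mu X ->
    (\int[P]_w wasserstein p (empirical_measure (fun j => X j w)) mu <=
     (2 * d%:R * C0 * (Num.sqrt (1 + fmax * flux_energy 2 K d) *
       n%:R `^ (- d%:R^-1)))%:E)%E.
  move=> d2 n K n0 Nn KN disp W P X iidX.
  have nR0 : 0 < n%:R :> R by rewrite ltr0n.
  apply: (le_trans (E 2%N K n isT n0 Nn _ disp W P X iidX)) => [m mK|].
    apply: halving_tail => // l; first exact: level_weight_ge0.
    exact: level_weight_dyadic.
  rewrite lee_fin -/C0.
  have -> : 2 * d%:R * C0 * (Num.sqrt (1 + fmax * flux_energy 2 K d) *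
       n%:R `^ (- d%:R^-1)) = d%:R * (2 * n%:R `^ (- d%:R^-1)) *
       Num.sqrt (1 + fmax * flux_energy 2 K d) * C0 by ring.
  rewrite ler_wpM2r// ler_pM ?sqrtr_ge0 ?divr_ge0 ?ler_wpM2l//.
  have fe0 := flux_energy_ge0 (R := R) 2 K d.
  apply: ler_wsqrtr; rewrite lerD2l ler_pdivrMr// -mulrA mulrC.
  by rewrite ler_wpM2l ?ler_nat// mulr_ge0 ?(ltW fmax0).
(* A single scale, in base [B = n]: dyadic scales would lose a logarithm in the sup bound. *)
have [d1|d1] := eqVneq d 1%N.
  subst d; exists (C0 * Num.sqrt (1 + 4 * fmax)) => n n0 _ disp W P X iidX.
  have nR0 : 0 < n%:R :> R by rewrite ltr0n.
  have Nn : ((n ^ 1) ^ 1 <= n)%N by rewrite !expn1.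
  apply: (le_trans (E n 1%N n n0 n0 Nn _ disp W P X iidX)) => [m|].
    rewrite ltnS leqn0 => /eqP ->.
    by rewrite big_nat1 ler_peMl ?level_weight_ge0// ler1n.
  rewrite lee_fin -/C0 !expn1 flux_energy_single_level /convergence_rate.
  rewrite powRN powR12_sqrt// mulrC -!mulrA ler_wpM2l// mul1r.
  rewrite ler_pdivrMl//.
  have -> : n%:R * (Num.sqrt (1 + 4 * fmax) / Num.sqrt n%:R) =
      Num.sqrt (1 + 4 * fmax) * Num.sqrt n%:R.
    rewrite -{1}(sqr_sqrtr (ltW nR0)); field.
    by rewrite gt_eqF ?sqrtr_gt0.
  rewrite -sqrtrM ?addr_ge0 ?mulr_ge0 ?(ltW fmax0)//.
  apply: ler_wsqrtr; rewrite [leRHS]mulrDl [1 * _]mul1r lerD ?ler1n//.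
  rewrite le_eqVlt; apply/orP; left; apply/eqP.
  by field; rewrite gt_eqF.
have [d2|d2] := eqVneq d 2%N.
  subst d; have ln20 : 0 < ln 2 :> R by rewrite ln_gt0// ltr1n.
  pose c := (1 + 16 * fmax) / ln 2.
  have c0 : 0 <= c by rewrite divr_ge0 ?addr_ge0 ?mulr_ge0 ?ltW.
  exists (2 * 2 * C0 * Num.sqrt c) => n n0 n2 disp W P X iidX.
  have [K [Nn KN Kln]] := @dyadic_scale R 2 n isT n0.
  have lnn : ln 2 <= ln n%:R :> R.
    by rewrite ler_ln ?posrE ?ltr0n// ler_nat; exact: n2.
  have lnn0 : 0 <= ln n%:R :> R by rewrite (le_trans (ltW ln20)).
  apply: (le_trans (Edyadic isT n K n0 Nn KN disp W P X iidX)).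
  rewrite lee_fin /convergence_rate powR12_sqrt// -[leRHS]mulrA.
  rewrite ler_wpM2l ?mulr_ge0// mulrA ler_wpM2r ?powR_ge0//.
  rewrite -sqrtrM//; apply: ler_wsqrtr; rewrite flux_energy_dyadic2 /c.
  rewrite mulrAC ler_pdivlMr//.
  have := ler_wpM2l (ltW fmax0) Kln.
  move: (ln n%:R) (ln 2) (K%:R) lnn => x y k xy; lra.
have d3 : (3 <= d)%N by lia.
exists (2 * d%:R * C0 * Num.sqrt (1 + fmax * (8 * 2 ^+ d))) => n n0 _ disp W P X iidX.
have [K [Nn KN _]] := dyadic_scale R d_ge1 n0.
apply: (le_trans (Edyadic (ltnW d3) n K n0 Nn KN disp W P X iidX)).
have -> : convergence_rate R d n = n%:R `^ (- d%:R^-1).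
  by case: d d3 {d_ge1 mu f f_meas f_bounds f_density C0 C00 E Edyadic d1 d2 X iidX Nn KN}
    => [//|[//|[//|d]]].
rewrite lee_fin -[leRHS]mulrA ler_wpM2l ?mulr_ge0// ler_wpM2r ?powR_ge0//.
by apply: ler_wsqrtr; rewrite lerD2l ler_wpM2l ?(ltW fmax0)// flux_energy_dyadic.
Qed.
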